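(* Assume that $\theta_K\in\big(0,\tfrac{h_K}{d\,C_{int,1}^2}\big]$ for every $K\in\mathcal K_h$. Then the bilinear form $a_{loc,h}(\cdot,\cdot)$ is uniformly bounded on $V_{0h,*}\times V_{0h}$, i.e., there exists a positive constant $\mu_{loc,b}$ that does not depend on $h_K$ such that $$|a_{loc,h}(u,v_h)|\le\mu_{loc,b}\,|||u|||_{loc,h,*}\,|||v_h|||_{loc,h}\qquad\text{for all }u\in V_{0h,*},\ v_h\in V_{0h}.$$
   Context: Domain: $\Omega\subset\mathbb R^d$, $d\in\{1,2,3\}$, is a bounded Lipschitz domain, $0<T<\infty$, $Q=\Omega\times(0,T)$, $\Sigma=\partial\Omega\times(0,T)$, $\Sigma_0=\Omega\times\{0\}$, $\Sigma_T=\Omega\times\{T\}$. For a set $S$, $(\cdot,\cdot)_S$ and $\|\cdot\|_S$ are the $L_2(S)$ inner product and norm. $\nabla_x$, $\Delta_x$ are the spatial gradient and Laplacian. Function spaces: $V^{1,0}_0=\{u\in L_2(Q):\nabla_x u\in[L_2(Q)]^d,\ u=0\text{ on }\Sigma\}$; $V^1_{0,\underline 0}=\{u\in V^{1,0}_0:\partial_t u\in L_2(Q),\ u=0\text{ on }\Sigma_0\}$; $V^{\Delta_x,1}_0=\{u\in V^{1,0}_0:\Delta_x u\in L_2(Q),\ \partial_t u\in L_2(Q)\}$; $V^{\Delta_x,1}_{0,\underline 0}=\{u\in V^{\Delta_x,1}_0: u=0\text{ on }\Sigma_0\}$. Discretization (single-patch isogeometric analysis): $\hat Q=(0,1)^{d+1}$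 is the parameter domain with a tensor-product mesh $\hat{\mathcal K}_h$ of open knot spans (possibly locally refined), and $\hat{\mathcal S}^p_h$ is a space of splines (B-splines, NURBS or THB-splines) of degree $p$ in every direction, built on open knot vectors. It is assumed that $p\ge2$ and that all interior knot multiplicities $m$ satisfy $m\le p-1$. The geometry map $\Phi:\hat Q\to Q=\Phi(\hat Q)$ is a spline/NURBS map, invertible with smooth inverse on each element. Physical elements are $K=\Phi(\hat K)$, $\hat K\in\hat{\mathcal K}_h$, forming the mesh $\mathcal K_h$. Put $V_h:=\{\hat s\circ\Phi^{-1}:\hat s\in\hat{\mathcal S}^p_h\}$ and $V_{0h}:=V_h\cap V^1_{0,\underline 0}$; then $V_{0h}\subset C^1(\overline Q)$ and $V_{0h}\subset V^{\Delta_x,1}_{0,\underline 0}$. The local mesh size is $h_K=\mathrm{diam}(K)$, $h=\max_K h_K$, and the mesh is quasi-uniform: $h_K\le h\le C_u h_K$. The constant $C_{int,1}$ (associated with $K$) is that of the inverse inequality $\|\nabla_x v_h\|_K\le C_{int,1}h_K^{-1}\|v_h\|_K$, $v_h\in V_h$; it does not depend on $K\in\mathcal K_h$. Stabilization: $\delta_K:=\theta_K h_K$ with $\theta_K>0$. Bilinear form: for $u\in V_{0h,*}$ (defined below) and $v_h\in V_{0h}$, $$a_{loc,h}(u,v_h)=(\partial_t u,v_h)_Q+(\nabla_x u,\nabla_x v_h)_Q+\sum_{K\in\mathcal K_h}\delta_K\Big((\partial_t u,\partial_t v_h)_K+(\nabla_x u,\nabla_x\partial_t v_h)_K-\langle n_x^{\partial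 K}\cdot\nabla_x u,\partial_t v_h\rangle_{\partial K}\Big),$$ where $n_x^{\partial K}$ is the spatial part of the exterior unit normal to $\partial K$ and $\langle\cdot,\cdot\rangle_{\partial K}$ is the $H^{-1/2}(\partial K)\times H^{1/2}(\partial K)$ duality product, so that $(\nabla_x u,\nabla_x\partial_t v_h)_K-\langle n_x^{\partial K}\cdot\nabla_x u,\partial_t v_h\rangle_{\partial K}=-(\Delta_x u,\partial_t v_h)_K$. Norms and space: $V_{0h,*}:=\big(V^1_{0,\underline 0}\cap V^{\Delta_x,1}_{0,\underline 0}\big)+V_{0h}$, $$|||v|||_{loc,h}^2=\|\nabla_x v\|_Q^2+\tfrac12\|v\|_{\Sigma_T}^2+\sum_{K\in\mathcal K_h}\delta_K\|\partial_t v\|_K^2,$$ $$|||v|||_{loc,h,*}^2=|||v|||_{loc,h}^2+\sum_{K\in\mathcal K_h}\big(\delta_K^{-1}\|v\|_K^2+\delta_K\|\Delta_x v\|_K^2\big).$$ *)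

(* Defs.v *)
From HB Require Import structures.
From mathcomp Require Import all_boot all_order all_algebra.
From mathcomp Require Import all_classical all_reals all_analysis.

Set Implicit Arguments.
Unset Strict Implicit.
Unset Printing Implicit Defensive.

Import Order.TTheory GRing.Theory Num.Theory.
Import numFieldNormedType.Exports.

Local Open Scope classical_set_scope.
Local Open Scope ring_scope.

Definition rV_display : measure_display -> measure_display.
Proof. exact. Qed.

Section rV_measurable.
Context {R : realType} (n : nat).

Let coord : 'I_n -> 'rV[R]_n -> R := fun i x => x ord0 i.

Let rV_set0 : g_sigma_preimage coord set0.
Proof. exact: sigma_algebra0. Qed.

Let rV_setC A : g_sigma_preimage coord A -> g_sigma_preimage coord (~` A).
Proof. exact: sigma_algebraC. Qed.

Let rV_bigcup (F : (set 'rV[R]_n)^nat) :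
  (forall i, g_sigma_preimage coord (F i)) ->
  g_sigma_preimage coord (\bigcup_i (F i)).
Proof. exact: sigma_algebra_bigcup. Qed.

HB.instance Definition _ := @isMeasurable.Build (rV_display default_measure_display)
  'rV[R]_n (g_sigma_preimage coord) rV_set0 rV_setC rV_bigcup.

Lemma measurable_coord i :
  measurable_fun [set: 'rV[R]_n] (fun x : 'rV[R]_n => x ord0 i).
Proof.
move=> _ A mA; apply: sub_sigma_algebra.
by rewrite (bigD1 i) //=; left; exists A.
Qed.

Lemma measurable_fun_rV d (T : measurableType d) (f : T -> 'rV[R]_n) :
  (forall i, measurable_fun [set: T] (fun x => f x ord0 i)) ->
  measurable_fun [set: T] f.
Proof.
move=> mf _ A mA; rewrite setTI.
suff: measurable `<=` [set B : set 'rV[R]_n | measurable (f @^-1` B)] by apply.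
apply: smallest_sub => [|B]; first split => /=.
- by rewrite preimage_set0.
- by move=> C mC; rewrite setTD preimage_setC; exact: measurableC.
- by move=> F mF; rewrite preimage_bigcup; exact: bigcupT_measurable.
- elim/big_ind: _ => // [C D IC ID [/IC|/ID]//|i _ [C mC <-]].
  by rewrite setTI; have := mf i measurableT C mC; rewrite setTI.
Qed.

End rV_measurable.

Section lebesgue_rV.
Context {R : realType}.

Definition rV_cons n (z : 'rV[R]_n * measurableTypeR R) : 'rV[R]_n.+1 :=
  row_mx (z.2)%:M z.1 : 'rV[R]_(1 + n).

Lemma measurable_rV_cons n :
  measurable_fun [set: 'rV[R]_n * measurableTypeR R] (@rV_cons n).
Proof.
apply: measurable_fun_rV => i; rewrite /rV_cons.
case: (split_ordP (i : 'I_(1 + n))) => j ->.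
- rewrite (_ : (fun _ => _) = snd) //.
  by apply/funext => z; apply: etrans (row_mxEl _ _ _ _) _; rewrite mxE (ord1 j).
- rewrite (_ : (fun _ => _) = (fun v : 'rV[R]_n => v ord0 j) \o fst).
    apply: measurableT_comp; last exact: measurable_fst.
    exact: measurable_coord.
  by apply/funext => z; exact: row_mxEr.
Qed.

(* The pushforward of [mu x lebesgue_measure] under the identification of
   [R^n x R] with [R^n.+1]. *)
Definition rV_cons_measure n (mu : {measure set 'rV[R]_n -> \bar R}) :
    set 'rV[R]_n.+1 -> \bar R :=
  pushforward (mu \x lebesgue_measure)%E (@rV_cons n).

HB.instance Definition _ n (mu : {measure set 'rV[R]_n -> \bar R}) :=
  Measure.copy (rV_cons_measure mu)
    (measure_function_pushforward__canonical__measure_function_Measure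
      (mu \x lebesgue_measure)%E (@measurable_rV_cons n)).

Fixpoint lebesgue_rV n : {measure set 'rV[R]_n -> \bar R} :=
  match n with
  | 0 => \d_(0 : 'rV[R]_0)
  | m.+1 => rV_cons_measure (lebesgue_rV m)
  end.

End lebesgue_rV.

(* Points [(x, t)] of [R^d x R]; vectors carry the sup norm of the library,
   which only matters through the topology it defines. *)
Notation spacetime R d := ('rV[R]_d * R)%type.

Section spacetime.
Context {R : realType} {d : nat}.
Implicit Types (D : set (spacetime R d)) (u v : spacetime R d -> R).

Definition dir_x (i : 'I_d) : spacetime R d := (delta_mx ord0 i, 0).
Definition dir_t : spacetime R d := (0, 1).

(* [measurableTypeR R] is [R], as the carrier of [lebesgue_measure]. *)
Definition lebesgue_st :
    {measure set ('rV[R]_d * measurableTypeR R) -> \bar R} :=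
  (lebesgue_rV d \x lebesgue_measure)%E.

Definition L2 d' (X : measurableType d') (mu : {measure set X -> \bar R})
    (D : set X) (f : X -> R) : Prop :=
  measurable_fun D f /\ mu.-integrable D (fun x => (f x ^+ 2)%:E).

Definition inner D u v : R := \int[lebesgue_st]_(z in D) (u z * v z).
Definition norm2 D u : R := inner D u u.
Definition normL2 D u : R := Num.sqrt (norm2 D u).

End spacetime.

Section differentiability.
Context {R : realType} {V W : normedModType R}.

Definition iterated_derive (f : V -> W) (vs : seq V) : V -> W :=
  foldr (fun v g => 'D_v g) f vs.

Definition Ck (k : nat) (f : V -> W) : Prop :=
  forall vs : seq V,
    ((size vs <= k)%N -> continuous (iterated_derive f vs)) /\
    ((size vs < k)%N -> forall x v, derivable (iterated_derive f vs) x v).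

Definition smooth (f : V -> W) : Prop := forall k, Ck k f.

End differentiability.

Section weak_derivatives.
Context {R : realType} {d : nat}.
Implicit Types (D : set (spacetime R d)) (u g : spacetime R d -> R).

Definition test_function (k : nat) D (phi : spacetime R d -> R) : Prop :=
  let supp := closure [set z | phi z != 0] in
  [/\ Ck k phi, compact supp & supp `<=` D].

(* As in Gilbarg-Trudinger, first derivatives are tested with C^1 functions and
   the Laplacian with C^2 functions of compact support; by mollification this
   is the same as testing with C^infinity ones. *)
Definition weak_derivative D (e : spacetime R d) u g : Prop :=
  forall phi, test_function 1 D phi ->
    inner D u ('D_e phi) = - inner D g phi.

Definition laplace_x (phi : spacetime R d -> R) (z : spacetime R d) : R :=
  \sum_(i < d) 'D_(dir_x i) ('D_(dir_x i) phi) z.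

Definition weak_laplacian D u g : Prop :=
  forall phi, test_function 2 D phi ->
    inner D u (laplace_x phi) = inner D g phi.

Definition has_wd D e u : Prop :=
  exists g, L2 lebesgue_st D g /\ weak_derivative D e u g.
Definition has_wlap D u : Prop :=
  exists g, L2 lebesgue_st D g /\ weak_laplacian D u g.

(* The weak derivative in direction [e] and the weak spatial Laplacian on [D]
   as (representatives of) elements of [L_2(D)]; zero when there is none. *)
Definition wd D e u : spacetime R d -> R :=
  xget (fun=> 0) [set g | L2 lebesgue_st D g /\ weak_derivative D e u g].
Definition wlap D u : spacetime R d -> R :=
  xget (fun=> 0) [set g | L2 lebesgue_st D g /\ weak_laplacian D u g].

Definition inner_grad D u v : R :=
  \sum_(i < d) inner D (wd D (dir_x i) u) (wd D (dir_x i) v).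

(* [<n_x . nabla_x u, v>] on the boundary of [D]: the normal trace of the field
   [nabla_x u] as the functional given by Green's identity, which is how a
   normal trace in [H^{-1/2}] is defined for fields without a classical
   restriction to the boundary. *)
Definition conormal_pairing D u v : R :=
  inner D (wlap D u) v + inner_grad D u v.

End weak_derivatives.

Section domains.
Context {R : realType} {d : nat}.

(* Near each boundary point, and in suitable orthonormal coordinates,
   [Omega] is the set above the graph of a Lipschitz function of the
   coordinates other than the [i]-th. *)
Definition lipschitz_domain (Omega : set 'rV[R]_d) : Prop :=
  [/\ Omega !=set0, open Omega, connected Omega, bounded_set Omega &
   forall x0, (closure Omega `\` Omega) x0 ->
   exists (A : 'M[R]_d) (i : 'I_d) (gamma : 'rV[R]_d.-1 -> R) (L r : R),
     [/\ A *m A^T = 1%:M,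
         0 < r,
         forall y z, `|gamma y - gamma z| <= L * `|y - z| &
         forall x, `|x - x0| < r ->
           (Omega x <-> gamma (col' i (x *m A)) < (x *m A) ord0 i)]].

Definition cylinder (Omega : set 'rV[R]_d) (T : R) : set (spacetime R d) :=
  Omega `*` `]0, T[.

End domains.

Section function_spaces.
Context {R : realType} {d : nat} (Omega : set 'rV[R]_d) (T : R).
Implicit Types u : spacetime R d -> R.

Local Notation Q := (cylinder Omega T).

Definition weak_dt u := wd Q dir_t u.

(* [g] is the trace of [u] on [Omega x {tau}], i.e. the value at [u] of the
   extension by continuity, for the norm of [u] and [d_t u] in [L_2(Q)], of
   the restriction of functions continuously differentiable up to the
   boundary. *)
Definition is_time_trace (tau : R) u (g : 'rV[R]_d -> R) : Prop :=
  L2 (lebesgue_rV d) Omega g /\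
  exists phi : nat -> spacetime R d -> R,
  [/\ forall n, Ck 1 (phi n),
      normL2 Q (phi n \- u) @[n --> \oo] --> 0,
      normL2 Q ('D_dir_t (phi n) \- weak_dt u) @[n --> \oo] --> 0 &
      (\int[lebesgue_rV d]_(x in Omega) (phi n (x, tau) - g x) ^+ 2)
        @[n --> \oo] --> 0].

Definition time_trace (tau : R) u : 'rV[R]_d -> R :=
  xget (fun=> 0) [set g | is_time_trace tau u g].

(* [u = 0] on [Sigma]: [u] is a limit, for the norm of [u] and [nabla_x u] in
   [L_2(Q)], of functions that vanish near the lateral boundary. *)
Definition zero_lateral_trace u : Prop :=
  exists phi : nat -> spacetime R d -> R,
  [/\ forall n, Ck 1 (phi n),
      forall n, exists2 F : set 'rV[R]_d, compact F /\ F `<=` Omega &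
        forall x t, ~ F x -> phi n (x, t) = 0,
      normL2 Q (phi n \- u) @[n --> \oo] --> 0 &
      forall i, normL2 Q ('D_(dir_x i) (phi n) \- wd Q (dir_x i) u)
        @[n --> \oo] --> 0].

(* [V^{1,0}_0], [V^1_{0,\underline 0}], [V^{Delta_x,1}_0] and
   [V^{Delta_x,1}_{0,\underline 0}] *)
Definition V10_0 u : Prop :=
  [/\ L2 lebesgue_st Q u, forall i, has_wd Q (dir_x i) u &
      zero_lateral_trace u].
Definition V1_00 u : Prop :=
  [/\ V10_0 u, has_wd Q dir_t u & is_time_trace 0 u (fun=> 0)].
Definition VD1_0 u : Prop :=
  [/\ V10_0 u, has_wlap Q u & has_wd Q dir_t u].
Definition VD1_00 u : Prop := VD1_0 u /\ is_time_trace 0 u (fun=> 0).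

Definition norm2_SigmaT u : R :=
  \int[lebesgue_rV d]_(x in Omega) (time_trace T u x) ^+ 2.

End function_spaces.

Section splines.
Context {R : realType}.

Definition open_knot_vector (p : nat) (k : seq R) : Prop :=
  [/\ sorted <=%R k, all (fun c => 0 <= c <= 1) k,
      count_mem 0 k = p.+1, count_mem 1 k = p.+1 &
      forall c, 0 < c < 1 -> (count_mem c k <= p.-1)%N].

(* Cox-de Boor recursion; the convention 0/0 = 0 is that of the library. *)
Fixpoint bspline (k : seq R) (p i : nat) (x : R) : R :=
  match p with
  | 0 => if k`_i <= x < k`_i.+1 then 1 else 0
  | q.+1 =>
      (x - k`_i) / (k`_(i + q.+1)%N - k`_i) * bspline k q i x +
      (k`_(i + q.+2)%N - x) / (k`_(i + q.+2)%N - k`_i.+1) * bspline k q i.+1 x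
  end.

Definition knot_span (k : seq R) (a b : R) : bool :=
  [&& a \in k, b \in k, a < b & ~~ has (fun c => a < c < b) k].

Context {n : nat}.
Implicit Types (k : 'I_n -> seq R) (xi : 'rV[R]_n).

Definition cube : set 'rV[R]_n := [set xi : 'rV[R]_n | forall j, 0 < xi ord0 j < 1].
Definition closed_cube : set 'rV[R]_n :=
  [set xi : 'rV[R]_n | forall j, 0 <= xi ord0 j <= 1].

Definition multi_index (p : nat) k : set {ffun 'I_n -> nat} :=
  [set i | forall j, (i j + p.+1 < size (k j))%N].

Definition tensor_bspline (p : nat) k (i : {ffun 'I_n -> nat}) xi : R :=
  \prod_(j < n) bspline (k j) p (i j) (xi ord0 j).

Definition tensor_basis (p : nat) k : set ('rV[R]_n -> R) :=
  tensor_bspline p k @` multi_index p k.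

Definition cells k : set (set 'rV[R]_n) :=
  [set C | exists a b : 'I_n -> R, (forall j, knot_span (k j) (a j) (b j)) /\
     C = [set xi : 'rV[R]_n | forall j, a j < xi ord0 j < b j]].

(* Data of a (truncated hierarchical, rational) spline space in [n] variables:
   knot vectors for each level and direction, the cells of each level that are
   refined, and weights for the basis of level 0.  Tensor-product B-splines and
   NURBS have [levels = 0], non-rational splines have unit weights. *)
Record spline_data := SplineData {
  levels : nat;
  knots : nat -> 'I_n -> seq R;
  refined : nat -> set (set 'rV[R]_n);
  weight : {ffun 'I_n -> nat} -> R }.

Variables (p : nat) (S : spline_data).

Definition subdomain (l : nat) : set 'rV[R]_n :=
  if l is m.+1 then \bigcup_(C in refined S m) closure C else closed_cube.

Definition spline_admissible : Prop :=
  [/\ forall l j, open_knot_vector p (knots S l j),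
      forall l j, subseq (knots S l j) (knots S l.+1 j),
      forall l C, refined S l C -> cells (knots S l) C /\ C `<=` subdomain l,
      forall l, (levels S <= l)%N -> refined S l = set0 &
      forall i, multi_index p (knots S 0) i -> 0 < weight S i].

Definition parameter_mesh : set (set 'rV[R]_n) :=
  [set C | exists l, [/\ cells (knots S l) C, C `<=` subdomain l &
                         ~ refined S l C]].

Definition support_in (f : 'rV[R]_n -> R) (D : set 'rV[R]_n) : Prop :=
  forall xi, cube xi -> f xi != 0 -> D xi.

(* [g] is the truncation of [f] with respect to level [l]: the terms of the
   level-[l] expansion of [f] with support in [subdomain l] are dropped. *)
Definition truncation (l : nat) (f g : 'rV[R]_n -> R) : Prop :=
  exists c : {ffun 'I_n -> nat} -> R,
    let I := multi_index p (knots S l) in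
    let B := tensor_bspline p (knots S l) in
    (forall xi, cube xi -> f xi = \sum_(i \in I) c i * B i xi) /\
    g = (fun xi => \sum_(i \in I `&` [set i | ~ support_in (B i) (subdomain l)])
                     c i * B i xi).

Fixpoint thb_basis (l : nat) : set ('rV[R]_n -> R) :=
  match l with
  | 0 => tensor_basis p (knots S 0)
  | m.+1 =>
      [set g | exists f, [/\ thb_basis m f, ~ support_in f (subdomain m.+1) &
                             truncation m.+1 f g]] `|`
      [set g | tensor_basis p (knots S m.+1) g /\
               support_in g (subdomain m.+1)]
  end.

Definition weight_function (xi : 'rV[R]_n) : R :=
  \sum_(i \in multi_index p (knots S 0))
     weight S i * tensor_bspline p (knots S 0) i xi.

Definition spline_space : set ('rV[R]_n -> R) :=
  [set s | exists (m : nat) (c : 'I_m -> R) (g : 'I_m -> 'rV[R]_n -> R),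
     (forall a, thb_basis (levels S) (g a)) /\
     forall xi, cube xi ->
       s xi = (\sum_(a < m) c a * g a xi) / weight_function xi].

End splines.
Arguments spline_data R n : clear implicits.

Section geometry.
Context {R : realType} {d : nat}.

(* The inverse is smooth up to the boundary of each element [Phi @` C]. *)
Definition geometry_map (p : nat) (S : spline_data R d.+1)
    (Phi : 'rV[R]_d.+1 -> spacetime R d) (Q : set (spacetime R d)) : Prop :=
  [/\ set_bij cube Q Phi,
      forall i, spline_space p S (fun xi => (Phi xi).1 ord0 i),
      spline_space p S (fun xi => (Phi xi).2) &
      forall C, parameter_mesh S C ->
        exists2 G : spacetime R d -> 'rV[R]_d.+1, smooth G &
          forall xi, C xi -> G (Phi xi) = xi].

Definition euclidean_dist (z w : spacetime R d) : R :=
  Num.sqrt (\sum_(i < d) (z.1 ord0 i - w.1 ord0 i) ^+ 2 + (z.2 - w.2) ^+ 2).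

Definition diam (K : set (spacetime R d)) : R :=
  sup [set r | exists z w, [/\ K z, K w & r = euclidean_dist z w]].

(* Every element of [S] lies in an element of [S']; with [S = S'] this holds
   trivially (isoparametric case). *)
Definition refines (S S' : spline_data R d.+1) : Prop :=
  forall C, parameter_mesh S C ->
    exists2 C', parameter_mesh S' C' & C `<=` C'.

End geometry.

Section scheme.
Context {R : realType} {d : nat}.
Variables (Omega : set 'rV[R]_d) (T : R) (p : nat) (S : spline_data R d.+1).
Variable Phi : 'rV[R]_d.+1 -> spacetime R d.
Implicit Types u v : spacetime R d -> R.

Local Notation Q := (cylinder Omega T).
Local Notation dt := (weak_dt Omega T).

Definition mesh : set (set (spacetime R d)) :=
  [set Phi @` C | C in parameter_mesh S].

Definition mesh_size : R := sup [set diam K | K in mesh].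

Definition quasi_uniform (Cu : R) : Prop :=
  forall K, mesh K -> diam K <= mesh_size <= Cu * diam K.

Definition Vh v : Prop :=
  exists2 s, spline_space p S s & forall xi, cube xi -> v (Phi xi) = s xi.

Definition V0h v : Prop := Vh v /\ V1_00 Omega T v.

Definition V0h_star u : Prop :=
  exists w v, [/\ V1_00 Omega T w /\ VD1_00 Omega T w, V0h v & u = w \+ v].

Definition inverse_inequality (C : R) : Prop :=
  forall K v, mesh K -> Vh v ->
    Num.sqrt (inner_grad K v v) <= C * (diam K)^-1 * normL2 K v.

Variable theta : set (spacetime R d) -> R.

Definition delta (K : set (spacetime R d)) : R := theta K * diam K.

Definition a_loc u v : R :=
  inner Q (dt u) v + inner_grad Q u v +
  \sum_(K \in mesh) delta K *
    (inner K (dt u) (dt v) + inner_grad K u (dt v)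
     - conormal_pairing K u (dt v)).

Definition norm2_loc v : R :=
  inner_grad Q v v + 2^-1 * norm2_SigmaT Omega T v +
  \sum_(K \in mesh) delta K * norm2 K (dt v).

Definition norm2_loc_star v : R :=
  norm2_loc v +
  \sum_(K \in mesh)
     ((delta K)^-1 * norm2 K v + delta K * norm2 K (wlap K v)).

Definition norm_loc v : R := Num.sqrt (norm2_loc v).
Definition norm_loc_star v : R := Num.sqrt (norm2_loc_star v).

End scheme.

(* Main.v *)
Require Import Defs.
From mathcomp Require Import all_boot all_order all_algebra.
From mathcomp Require Import all_classical all_reals all_analysis.
From HB Require Import structures.
From mathcomp Require Import measurable_realfun ring lra.

Import Order.TTheory GRing.Theory Num.Theory.
Import numFieldNormedType.Exports.

Local Open Scope classical_set_scope.
Local Open Scope ring_scope.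

(** The conormal pairing is defined by Green's identity, so on each element
    the stabilization term of [a_loc u v] is
    [delta_K ((dt u, dt v)_K - (wlap u, dt v)_K)], and Cauchy-Schwarz bounds
    its sum by the product of the norms.  The same holds for the gradient
    term.  The term [(dt u, v)_Q] is not controlled in this way, because
    [dt u] carries the small weight [delta_K]; the time derivative has to be
    moved to [v]:
      [(dt u, v)_Q = (u(T), v(T))_Omega - (u, dt v)_Q],
    where the last term is split over the elements and estimated with the
    weights [delta_K^-1] on [u] and [delta_K] on [dt v].  All constants are
    absolute and the result holds with the constant [6].  Two facts carry
    this argument.

    Integration by parts in time ([integration_by_parts_time]).  The functions
    with vanishing initial trace are limits of C^1 functions, for which the
    identity follows from Fubini's theorem and the fundamental theorem of
    calculus.  The final trace exists because it is given by the time integral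
    of [dt u] ([final_trace_exists]).  The initial and final traces come with
    different approximating sequences.  They are treated separately, with the
    weights [t - T] and [t], each of which vanishes at the other end of the
    time interval, and the two weighted identities are subtracted
    ([weighted_green]).  Since [u] is a sum of two functions and [dt] selects
    an arbitrary representative of the weak derivative, additivity of [dt]
    almost everywhere is needed as well; it follows from the fundamental lemma
    of the calculus of variations ([orthogonal_to_test_functions_ae0]), proved
    with explicit C^1 bumps and Dynkin's lemma.

    The elements are measurable and cover the cylinder up to a null set
    ([measurable_mesh], [mesh_cover_ae]).  In the parameter domain, the cells of
    the hierarchical mesh cover all points that lie on no hyperplane through a
    knot ([parameter_mesh_cover]).  The geometry map sends such a hyperplane to
    a null set because the cube is a countable union of pieces on which the map
    is Lipschitz ([image_hyperplane_negligible]): this only uses that splines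
    are obtained from coordinates and step functions by ring operations and
    division. *)

Set Implicit Arguments.
Unset Strict Implicit.
Unset Printing Implicit Defensive.

(** Space-time with the sigma-algebra on which [lebesgue_st] is defined. *)
Notation mst R d := ('rV[R]_d * measurableTypeR R)%type.

(** * Square-integrable functions *)

Section square_integrable.
Context {R : realType} {disp : measure_display} {X : measurableType disp}.
Variables (mu : {measure set X -> \bar R}) (D : set X).
Hypothesis mD : measurable D.
Implicit Types f g h : X -> R.

Definition ip f g : R := \int[mu]_(x in D) (f x * g x).
Definition nrm f : R := Num.sqrt (ip f f).

Lemma L2_integrableM f g : L2 mu D f -> L2 mu D g ->
  mu.-integrable D (EFin \o (fun x => f x * g x)).
Proof.
move=> [mf f2] [mg g2].
apply: (@le_integrable _ _ _ _ _ mD _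
  (fun x => (f x ^+ 2)%:E + (g x ^+ 2)%:E)%E); last exact: integrableD.
- by apply/measurable_EFinP; exact: measurable_funM.
- move=> x _ /=; rewrite lee_fin [leRHS]ger0_norm ?addr_ge0 ?sqr_ge0 //.
  rewrite ler_norml; have := sqr_ge0 (f x - g x); have := sqr_ge0 (f x + g x).
  have := sqr_ge0 (f x); have := sqr_ge0 (g x).
  by rewrite !expr2 => *; apply/andP; split; nra.
Qed.

Lemma L2D f g : L2 mu D f -> L2 mu D g -> L2 mu D (f \+ g).
Proof.
move=> hf hg; split; first by apply: measurable_funD; [case: hf|case: hg].
have -> : (fun x => ((f \+ g) x ^+ 2)%:E) =
  (((fun x => (f x ^+ 2)%:E) \+ (fun x => (g x ^+ 2)%:E)) \+
   (fun x => 2%:E * (EFin \o (fun x => (f x * g x)%R)) x))%E.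
  apply/funext => x /=; rewrite -EFinM -!EFinD; congr EFin; ring.
apply: integrableD => //; first by apply: integrableD => //; [case: hf|case: hg].
by apply: integrableZl => //; exact: L2_integrableM.
Qed.

Lemma L2Z (c : R) f : L2 mu D f -> L2 mu D (fun x => c * f x).
Proof.
move=> [mf f2]; split; first by apply: measurable_funM => //; exact: measurable_cst.
have -> : (fun x => ((c * f x) ^+ 2)%:E) =
  (fun x => (c ^+ 2)%:E * (f x ^+ 2)%:E)%E.
  by apply/funext => x; rewrite -EFinM exprMn.
exact: integrableZl.
Qed.

Lemma L2N f : L2 mu D f -> L2 mu D (\- f).
Proof.
move=> /(L2Z (-1)); congr L2; apply/funext => x; by rewrite mulN1r.
Qed.

Lemma L2B f g : L2 mu D f -> L2 mu D g -> L2 mu D (f \- g).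
Proof. by move=> hf hg; exact: (L2D hf (L2N hg)). Qed.

Lemma L2_0 : L2 mu D (fun=> 0).
Proof.
split; first exact: measurable_cst.
have -> : (fun x : X => (0 ^+ 2 : R)%:E) = cst 0%E by apply/funext => x; rewrite expr0n.
exact: integrable0.
Qed.

Lemma L2S (E : set X) f : measurable E -> E `<=` D -> L2 mu D f -> L2 mu E f.
Proof.
move=> mE ED [mf f2]; split; first exact: measurable_funS mf.
exact: integrableS f2.
Qed.

Lemma L2_bounded f (M : R) : measurable_fun D f -> (mu D < +oo)%E ->
  (forall x, D x -> `|f x| <= M) -> L2 mu D f.
Proof.
move=> mf fin b; split => //.
apply: (@le_integrable _ _ _ _ _ mD _ (cst (M ^+ 2)%:E)).
- by apply/measurable_EFinP; exact: measurable_funX.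
- move=> x Dx /=; rewrite lee_fin !ger0_norm ?sqr_ge0 //.
  by rewrite -[leLHS]ger0_norm ?sqr_ge0 // normrX lerXn2r ?nnegrE ?(le_trans _ (b x Dx)) // b.
- by apply/integrableP; split; [exact: measurable_cst|rewrite integral_cst // lte_mul_pinfty].
Qed.

Lemma L2_integrable f : (mu D < +oo)%E -> L2 mu D f ->
  mu.-integrable D (EFin \o f).
Proof.
move=> fin hf.
have L21 : L2 mu D (fun=> 1).
  apply: (L2_bounded (M := 1) _ fin); first exact: measurable_cst.
  by move=> x _; rewrite normr1.
have := L2_integrableM hf L21.
by rewrite (_ : EFin \o (fun x => f x * 1) = EFin \o f) //; apply/funext => x /=; rewrite mulr1.
Qed.

Lemma L2Mbounded f g (M : R) : measurable_fun D g ->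
  (forall x, D x -> `|g x| <= M) -> L2 mu D f -> L2 mu D (fun x => g x * f x).
Proof.
move=> mg b [mf f2]; split; first exact: measurable_funM.
apply: (@le_integrable _ _ _ _ _ mD _ (fun x => (M ^+ 2)%:E * (f x ^+ 2)%:E)%E).
- by apply/measurable_EFinP; apply: measurable_funX; exact: measurable_funM.
- move=> x Dx /=; rewrite lee_fin -exprMn [leRHS]ger0_norm ?sqr_ge0 // [in leRHS]exprMn.
  rewrite ger0_norm ?sqr_ge0 // exprMn ler_wpM2r ?sqr_ge0 //.
  rewrite -[leLHS]ger0_norm ?sqr_ge0 // normrX -[leRHS]ger0_norm ?sqr_ge0 // normrX.
  rewrite lerXn2r ?nnegrE //; apply: le_trans (b x Dx) _; exact: ler_norm.
- exact: integrableZl.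
Qed.

Lemma ipC f g : ip f g = ip g f.
Proof. by apply: eq_Rintegral => x _; rewrite mulrC. Qed.

Lemma ipDl f g h : L2 mu D f -> L2 mu D g -> L2 mu D h ->
  ip (f \+ g) h = ip f h + ip g h.
Proof.
move=> hf hg hh; rewrite /ip -RintegralD //; try exact: L2_integrableM.
by apply: eq_Rintegral => x _ /=; rewrite mulrDl.
Qed.

Lemma ipZl (c : R) f g : L2 mu D f -> L2 mu D g ->
  ip (fun x => c * f x) g = c * ip f g.
Proof.
move=> hf hg; rewrite /ip -RintegralZl //; last exact: L2_integrableM.
by apply: eq_Rintegral => x _ /=; rewrite mulrA.
Qed.

Lemma ipBl f g h : L2 mu D f -> L2 mu D g -> L2 mu D h ->
  ip (f \- g) h = ip f h - ip g h.
Proof.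
move=> hf hg hh; rewrite /ip -RintegralB //; try exact: L2_integrableM.
by apply: eq_Rintegral => x _ /=; rewrite mulrBl.
Qed.

Lemma ip_ge0 f : 0 <= ip f f.
Proof. by apply: Rintegral_ge0 => x _; rewrite -expr2 sqr_ge0. Qed.

Lemma nrm_ge0 f : 0 <= nrm f.
Proof. exact: sqrtr_ge0. Qed.

Lemma sqr_nrm f : nrm f ^+ 2 = ip f f.
Proof. by rewrite /nrm sqr_sqrtr // ip_ge0. Qed.

Lemma ip_sqrD f g : L2 mu D f -> L2 mu D g ->
  ip (f \+ g) (f \+ g) = ip f f + 2 * ip f g + ip g g.
Proof.
move=> hf hg; have hfg := L2D hf hg.
rewrite ipDl // (ipC f (f \+ g)) (ipC g (f \+ g)) !ipDl // (ipC g f); ring.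
Qed.

(** The discriminant of the nonnegative quadratic polynomial
    [t |-> ip (f + t g) (f + t g)] is nonpositive. *)
Lemma Cauchy_Schwarz f g : L2 mu D f -> L2 mu D g ->
  `|ip f g| <= nrm f * nrm g.
Proof.
move=> hf hg.
have key t : 0 <= ip f f + 2 * t * ip f g + t ^+ 2 * ip g g.
  have htg := L2Z t hg; have := ip_ge0 (f \+ (fun x => t * g x)).
  rewrite ip_sqrD // (ipC f (fun x => t * g x)) !(ipZl t) //.
  rewrite (ipC g (fun x => t * g x)) (ipZl t) // (ipC g f) => h.
  by rewrite expr2 -!mulrA (mulrA 2) -mulrA.
have h2 : ip f g ^+ 2 <= ip f f * ip g g.
  have C0 := ip_ge0 g; have A0 := ip_ge0 f.
  have [C_eq0|C_neq0] := eqVneq (ip g g) 0.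
    have [->|B0] := eqVneq (ip f g) 0; first by rewrite expr0n /= mulr_ge0.
    have := key (- (ip f f + 1) / (2 * ip f g)).
    rewrite C_eq0 mulr0 addr0.
    have -> : 2 * (- (ip f f + 1) / (2 * ip f g)) * ip f g = - (ip f f + 1).
      by field.
    by move=> h; exfalso; lra.
  have Cp : 0 < ip g g by rewrite lt_def C_neq0.
  have := key (- ip f g / ip g g).
  have -> : ip f f + 2 * (- ip f g / ip g g) * ip f g +
      (- ip f g / ip g g) ^+ 2 * ip g g = ip f f - ip f g ^+ 2 / ip g g.
    by field.
  by rewrite subr_ge0 ler_pdivrMr.
rewrite /nrm -sqrtrM ?ip_ge0 // -[leLHS]sqrtr_sqr; exact: ler_wsqrtr.
Qed.

Lemma ler_nrmD f g : L2 mu D f -> L2 mu D g -> nrm (f \+ g) <= nrm f + nrm g.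
Proof.
move=> hf hg.
rewrite -[leRHS]ger0_norm ?addr_ge0 ?nrm_ge0 // -sqrtr_sqr; apply: ler_wsqrtr.
rewrite ip_sqrD // -!sqr_nrm.
have /(le_trans (ler_norm _)) := Cauchy_Schwarz hf hg.
rewrite !expr2; move: (nrm f) (nrm g) (ip f g) => a b c; nra.
Qed.

Lemma ler_nrmMbounded f g (M : R) : measurable_fun D g -> 0 <= M ->
  (forall x, D x -> `|g x| <= M) -> L2 mu D f ->
  nrm (fun x => g x * f x) <= M * nrm f.
Proof.
move=> mg M0 b hf; have hgf := L2Mbounded mg b hf.
rewrite -{1}(ger0_norm M0) -sqrtr_sqr -sqrtrM ?sqr_ge0 //; apply: ler_wsqrtr.
rewrite /ip -RintegralZl //; last exact: L2_integrableM.
apply: le_Rintegral => //; first exact: L2_integrableM.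
  have -> : EFin \o (fun x => M ^+ 2 * (f x * f x)) =
    (fun x => (M ^+ 2)%:E * (f x ^+ 2)%:E)%E.
    by apply/funext => x /=; rewrite EFinM expr2.
  by apply: integrableZl => //; case: hf.
move=> x Dx; have -> : g x * f x * (g x * f x) = `|g x| ^+ 2 * (f x * f x).
  by rewrite -normrX ger0_norm ?sqr_ge0 //; ring.
apply: ler_wpM2r; first by rewrite -expr2 sqr_ge0.
by rewrite lerXn2r ?nnegrE // b.
Qed.

Lemma cvg_nrm_ip (f_ g_ : nat -> X -> R) f g :
  (forall n, L2 mu D (f_ n)) -> (forall n, L2 mu D (g_ n)) ->
  L2 mu D f -> L2 mu D g ->
  nrm (f_ n \- f) @[n --> \oo] --> 0 -> nrm (g_ n \- g) @[n --> \oo] --> 0 ->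
  ip (f_ n) (g_ n) @[n --> \oo] --> ip f g.
Proof.
move=> hf_ hg_ hf hg cf cg; apply/subr_cvg0.
have h n : `|ip (f_ n) (g_ n) - ip f g| <=
    nrm (f_ n \- f) * (nrm (g_ n \- g) + nrm g) + nrm f * nrm (g_ n \- g).
  have hfn := L2B (hf_ n) hf; have hgn := L2B (hg_ n) hg.
  have -> : ip (f_ n) (g_ n) - ip f g =
      ip (f_ n \- f) (g_ n) + ip f (g_ n \- g).
    by rewrite ipBl // (ipC f (g_ n \- g)) ipBl // (ipC (g_ n) f) (ipC g f); ring.
  apply: le_trans (ler_normD _ _) _; apply: lerD; last exact: Cauchy_Schwarz.
  apply: le_trans (Cauchy_Schwarz hfn (hg_ n)) _.
  apply: ler_wpM2l; first exact: nrm_ge0.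
  rewrite (_ : nrm (g_ n) = nrm ((g_ n \- g) \+ g)); first exact: ler_nrmD.
  by congr nrm; apply/funext => x /=; rewrite subrK.
apply/norm_cvg0P.
apply: (@squeeze_cvgr _ _ _ _ (cst 0) (fun n => 
  nrm (f_ n \- f) * (nrm (g_ n \- g) + nrm g) + nrm f * nrm (g_ n \- g))).
- by apply: nearW => n; rewrite normr_ge0 h.
- exact: cvg_cst.
- rewrite (_ : (0 : R) = 0 * (0 + nrm g) + nrm f * 0); last by rewrite mul0r mulr0 addr0.
  apply: cvgD; first by apply: cvgM => //; apply: cvgD => //; exact: cvg_cst.
  by apply: cvgM => //; exact: cvg_cst.
Qed.

Lemma nrm_ae_eq f g : L2 mu D f -> L2 mu D g ->
  ae_eq mu D (EFin \o f) (EFin \o g) -> nrm f = nrm g.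
Proof.
move=> [mf f2] [mg g2] fg; congr Num.sqrt; congr fine.
apply: ae_eq_integral => //.
- by apply/measurable_EFinP; exact: measurable_funM.
- by apply/measurable_EFinP; exact: measurable_funM.
by apply: filterS fg => x /= h /h [->].
Qed.

End square_integrable.

(** * Lebesgue measure, coordinates and topology *)

Section box.
Context {R : realType}.

Definition cbox n (a b : 'I_n -> R) : set 'rV[R]_n :=
  [set x | forall i, a i <= x ord0 i <= b i].

Lemma measurable_cbox n (a b : 'I_n -> R) : measurable (cbox a b).
Proof.
have -> : cbox a b = \bigcap_(i in [set: 'I_n])
    (fun x : 'rV[R]_n => x ord0 i) @^-1` `[a i, b i].
  apply/seteqP; split => x /= h i; first by move=> _ /=; rewrite in_itv /=; exact: h.
  by have := h i I; rewrite /= in_itv.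
apply: fin_bigcap_measurable; first exact: finite_finset.
move=> i _; rewrite -[X in measurable X]setTI; exact: measurable_coord.
Qed.

Lemma rV_cons_ord0 n (z : 'rV[R]_n * measurableTypeR R) :
  rV_cons z ord0 ord0 = z.2.
Proof.
transitivity ((row_mx (z.2)%:M z.1 : 'rV[R]_(1 + n)) ord0 (lshift n (ord0 : 'I_1))).
  by congr (fun_of_matrix _ _ _); exact: val_inj.
by rewrite row_mxEl mxE.
Qed.

Lemma rV_cons_lift n (z : 'rV[R]_n * measurableTypeR R) i :
  rV_cons z ord0 (lift ord0 i) = z.1 ord0 i.
Proof.
transitivity ((row_mx (z.2)%:M z.1 : 'rV[R]_(1 + n)) ord0 (rshift 1 i)).
  by congr (fun_of_matrix _ _ _); exact: val_inj.
by rewrite row_mxEr.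
Qed.

Lemma lebesgue_rV_cbox n (a b : 'I_n -> R) : (forall i, a i <= b i) ->
  lebesgue_rV n (cbox a b) = (\prod_i (b i - a i))%:E.
Proof.
elim: n a b => [|n IH] a b ab /=.
  rewrite big_ord0 /dirac indicE mem_set // => -[] //.
pose a' i := a (lift ord0 i); pose b' i := b (lift ord0 i).
rewrite /rV_cons_measure /pushforward.
have -> : @rV_cons R n @^-1` cbox a b = cbox a' b' `*` `[a ord0, b ord0].
  apply/seteqP; split => -[x t] /=.
    move=> h; split => [i|]; first by have := h (lift ord0 i); rewrite rV_cons_lift.
    by have := h ord0; rewrite rV_cons_ord0 in_itv.
  move=> [h ht] i; case: (unliftP ord0 i) => [j|] ->.
    by rewrite rV_cons_lift; exact: h.
  by rewrite rV_cons_ord0; move: ht; rewrite /= in_itv.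
rewrite product_measure1E //; last exact: measurable_cbox.
rewrite IH; last by move=> i; exact: ab.
rewrite big_ord_recl /= mulrC EFinM; congr (_ * _)%E.
apply: etrans (lebesgue_measure_itv _) _; rewrite /= lte_fin; case: ltP => // h.
by rewrite (_ : b ord0 - a ord0 = 0) //; apply/eqP; rewrite subr_eq0 eq_le h ab.
Qed.

Lemma coord_le_norm n (x : 'rV[R]_n) i : `|x ord0 i| <= `|x|.
Proof.
rewrite -[leRHS]/(mx_norm x) /mx_norm.
exact: (le_bigmax _ (fun ij => `|x ij.1 ij.2|%:nng) (ord0, i)).
Qed.

Lemma rV_norm_le n (x : 'rV[R]_n) r : 0 <= r ->
  `|x| <= r <-> forall i, `|x ord0 i| <= r.
Proof.
move=> r0; split=> [h i|h]; first exact: le_trans (coord_le_norm _ _) h.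
rewrite -[leLHS]/(mx_norm x).
have [->//|/mx_norm_neq0[[i j] /= ->]] := eqVneq (mx_norm x) 0.
by rewrite (ord1 i).
Qed.

(** The fixpoint defining [lebesgue_rV] only returns a measure; Fubini's theorem
    needs it as a sigma-finite one. *)
Lemma lebesgue_rV_sigma_finite n :
  exists mu : {sigma_finite_measure set 'rV[R]_n -> \bar R},
    lebesgue_rV n = mu :> {measure set 'rV[R]_n -> \bar R}.
Proof.
have sf : sigma_finite [set: 'rV[R]_n] (lebesgue_rV n).
  exists (fun k => cbox (fun=> - k%:R) (fun=> k%:R)).
    apply/esym; rewrite -subTset => x _.
    have [k hk] : exists k : nat, forall i, `|x ord0 i| <= k%:R.
      exists (Num.truncn `|x|).+1 => i.
      apply: le_trans (ltW (truncnS_gt _)); exact: coord_le_norm.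
    exists k => // i; have := hk i; by rewrite ler_norml.
  move=> k; split; first exact: measurable_cbox.
  rewrite lebesgue_rV_cbox ?ltry // => i; apply: le_trans (ler0n _ k).
  by rewrite oppr_le0.
case: (lebesgue_rV n) sf => f c sf.
pose m : {measure set 'rV[R]_n -> \bar R} := Measure.Pack c.
pose mf := Measure_isSigmaFinite.Build _ _ _ m sf.
pose s : {sigma_finite_measure set 'rV[R]_n -> \bar R} := HB.pack f m mf.
by exists s.
Qed.

End box.

Section spacetime_balls.
Context {R : realType} {d : nat}.
Implicit Types (z c : spacetime R d).

Lemma st_norm_le z r : 0 <= r ->
  `|z| <= r <-> (forall i, `|z.1 ord0 i| <= r) /\ `|z.2| <= r.
Proof.
move=> r0; rewrite prod_normE ge_max; split => [/andP[]|[h1 h2]].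
  by move=> /(rV_norm_le _ r0).
by apply/andP; split => //; apply/(rV_norm_le _ r0).
Qed.

Lemma st_coord_le_norm z i : `|z.1 ord0 i| <= `|z|.
Proof. by have [/(_ (lexx _))[h _] _] := st_norm_le z (normr_ge0 z). Qed.

Lemma st_time_le_norm z : `|z.2| <= `|z|.
Proof. by have [/(_ (lexx _))[_ h] _] := st_norm_le z (normr_ge0 z). Qed.

Definition cball c (r : R) : set (spacetime R d) := [set z | `|z - c| <= r].

Lemma cballE c r : 0 <= r -> cball c r =
  cbox (fun i => c.1 ord0 i - r) (fun i => c.1 ord0 i + r) `*` `[c.2 - r, c.2 + r].
Proof.
move=> r0; apply/seteqP; split => z.
  move=> /(st_norm_le _ r0)[h1 h2]; split => [i|] /=.
    by have := h1 i; rewrite !mxE ler_distl.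
  by rewrite in_itv /= -ler_distl.
move=> [h1 h2]; apply/(st_norm_le _ r0); split => [i|].
  by have := h1 i; rewrite !mxE ler_distl.
by move: h2; rewrite /= in_itv /= -ler_distl.
Qed.

Lemma measurable_cball c r : 0 <= r ->
  measurable (cball c r : set ('rV[R]_d * measurableTypeR R)).
Proof.
by move=> r0; rewrite cballE //; apply: measurableX => //; exact: measurable_cbox.
Qed.

Lemma lebesgue_st_cball c r : 0 <= r ->
  lebesgue_st (cball c r) = ((2 * r) ^+ d.+1)%:E.
Proof.
move=> r0; rewrite cballE //.
have mb := measurable_cbox (fun i => c.1 ord0 i - r) (fun i => c.1 ord0 i + r).
have mi : measurable (`[c.2 - r, c.2 + r] : set (measurableTypeR R)) by exact: measurable_itv.
refine (etrans (product_measure1E (lebesgue_rV d) (@lebesgue_measure R) mb mi) _).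
rewrite lebesgue_rV_cbox; last by move=> i; lra.
rewrite exprSr EFinM; congr (_ * _)%E.
  congr EFin; transitivity (\prod_(i < d) (2 * r)).
    by apply: eq_bigr => i _; ring.
  by rewrite prodr_const card_ord.
apply: etrans (lebesgue_measure_itv _) _; rewrite /= lte_fin; case: ltP => h.
  by rewrite -EFinD; congr EFin; ring.
by rewrite (_ : r = 0) ?mulr0 //; apply/eqP; rewrite eq_le r0 andbT; lra.
Qed.

Definition rat_point (q : {ffun 'I_d -> rat} * rat) : spacetime R d :=
  (\row_i ratr (q.1 i), ratr q.2).

Lemma open_rat_cball (U : set (spacetime R d)) z : open U -> U z ->
  exists q k, `|z - rat_point q| < k.+1%:R^-1 /\ cball (rat_point q) k.+1%:R^-1 `<=` U.
Proof.
move=> oU Uz; have := open_nbhs_nbhs (conj oU Uz).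
rewrite -nbhs_ballE => -[e /= e0 he].
have [k hk] : exists k : nat, k.+1%:R^-1 < e / 2.
  by have /ltr_add_invr[k] : 0 < e / 2 by [lra]; rewrite add0r => ?; exists k.
have : 0 < k.+1%:R^-1 :> R by rewrite invr_gt0.
move: hk; set r := k.+1%:R^-1 => hk r0.
have dense (x : R) : exists q : rat, `|x - ratr q| < r / 2.
  have /rat_in_itvoo[q] : x - r / 2 < x + r / 2 by lra.
  by rewrite in_itv /= => h; exists q; rewrite distrC ltr_distl.
have [f hf] := choice (fun i : 'I_d => dense (z.1 ord0 i)).
have [q0 hq0] := dense z.2.
have zq : `|z - rat_point (finfun f, q0)| <= r / 2.
  apply/st_norm_le; first by lra.
  by split => [i|] /=; [rewrite !mxE ffunE; exact/ltW|exact/ltW].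
exists (finfun f, q0), k; rewrite -/r; split; first by lra.
move=> w hw; apply: he; rewrite ball_prod_normE /ball_ /=.
rewrite (_ : z - w = (z - rat_point (finfun f, q0)) - (w - rat_point (finfun f, q0))).
  apply: le_lt_trans (ler_normB _ _) _; move: hw; rewrite /cball /=; lra.
by rewrite opprB addrA subrK.
Qed.

(** The sigma-algebra of space-time is generated by coordinates, and the
    topology by a norm; they agree because rational balls form a countable
    base. *)
Lemma open_measurable_st (U : set (spacetime R d)) : open U ->
  measurable (U : set ('rV[R]_d * measurableTypeR R)).
Proof.
move=> oU.
have -> : U = \bigcup_(i in [set: ({ffun 'I_d -> rat} * rat) * nat])
    (if `[< cball (rat_point i.1) i.2.+1%:R^-1 `<=` U >]
     then cball (rat_point i.1) i.2.+1%:R^-1 else set0).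
  apply/seteqP; split => z.
    move=> /(open_rat_cball oU)[q [k [h1 h2]]]; exists (q, k) => //=.
    by rewrite asboolT // /cball /=; exact/ltW.
  by move=> [i _]; case: asboolP => // h /h.
apply: countable_bigcupT_measurable; first exact: countableP.
by move=> i; case: asboolP => // _; apply: measurable_cball; rewrite invr_ge0.
Qed.

Lemma continuous_measurable_st (f : spacetime R d -> R) : continuous f ->
  measurable_fun [set: 'rV[R]_d * measurableTypeR R] f.
Proof.
move=> cf; apply: (measurability _ (RGenOpens.measurableE R)).
move=> _ [_ [a [b ->] <-]]; rewrite setTI.
by apply: open_measurable_st; apply: open_comp => // x _; exact: cf.
Qed.

Lemma open_measurable_rV (U : set 'rV[R]_d) : open U -> measurable U.
Proof.
move=> oU; have -> : U = (fun x : 'rV[R]_d => (x, 0) : 'rV[R]_d * measurableTypeR R) @^-1`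
    (fst @^-1` U) by [].
have mp : measurable_fun [set: 'rV[R]_d] (fun x : 'rV[R]_d => (x, 0) : 'rV[R]_d * measurableTypeR R).
  by apply: measurable_fun_pair => //; exact: measurable_cst.
rewrite -[X in measurable X]setTI; apply: mp => //.
by apply: open_measurable_st; apply: open_comp => // x _; exact: cvg_fst.
Qed.

End spacetime_balls.

(** * C^1 functions, bumps and the fundamental theorem of calculus *)

Section C1_functions.
Context {R : realType} {V : normedModType R}.
Implicit Types (f g : V -> R) (x v : V).

Lemma Ck1P f : Ck 1 f <->
  [/\ continuous f, forall x v, derivable f x v & forall v, continuous ('D_v f)].
Proof.
split=> [h|[cf df cdf] [|v [|w vs]]]; first split.
- by have [+ _] := h [::]; apply.
- by have [_ +] := h [::]; apply.
- by move=> v; have [+ _] := h [:: v]; apply.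
- by split=> [_|_ x v]; [exact: cf|exact: df].
- by split=> [_|h]; [exact: cdf|exact: (False_rect _ (notF h))].
- by split=> h; exact: (False_rect _ (notF h)).
Qed.

(** Covers at once affine functions, with [C = 0], and the square of the
    positive part, with [C = 1]. *)
Lemma is_derive_quadratic f x v (a C : R) :
  (forall h : R, `|f (h *: v + x) - f x - h * a| <= C * h ^+ 2) ->
  is_derive x v f a.
Proof.
move=> hf; have C0 : 0 <= C.
  by have := hf 1; rewrite expr1n mulr1; exact: le_trans.
have C1 : 0 < C + 1 by lra.
have lim : h^-1 *: ((f \o shift x) (h *: v) - f x) @[h --> 0^'] --> a.
  apply/cvgrPdist_le => e e0; near=> h.
  have h0 : h != 0 by near: h; exact: nbhs_dnbhs_neq.
  have he : `|h| * C <= e.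
    apply: (@le_trans _ _ (`|h| * (C + 1))); first by rewrite ler_wpM2l // lerDl.
    rewrite -ler_pdivlMr //; near: h.
    exact: (dnbhs0_le (divr_gt0 e0 C1)).
  apply: le_trans he; rewrite /= -[_ *: _]/(h^-1 * (f (h *: v + x) - f x)).
  have -> : a - h^-1 * (f (h *: v + x) - f x) =
      - (h^-1 * (f (h *: v + x) - f x - h * a)) by field.
  rewrite normrN normrM normfV ler_pdivrMl ?normr_gt0 //; apply: le_trans (hf h) _.
  by rewrite [leRHS]mulrA -normrM -expr2 ger0_norm ?sqr_ge0 // mulrC.
by apply: DeriveDef; [apply/cvg_ex; exists a|rewrite /derive; exact: cvg_lim].
Unshelve. all: by end_near. Qed.

(** Reduces directional derivatives to functions of one real variable, for
    which the chain rule is known. *)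
Lemma is_derive_line f x v (a : R) :
  is_derive x v f a <-> is_derive (0 : R) 1 (fun s : R => f (s *: v + x)) a.
Proof.
have E : (fun h : R => h^-1 *: ((f \o shift x) (h *: v) - f x)) =
  (fun h : R => h^-1 *: (((fun s : R => f (s *: v + x)) \o shift 0) (h *: 1) -
    (fun s : R => f (s *: v + x)) 0)).
  by apply/funext => h /=; rewrite addr0 scale0r add0r /GRing.scale /= mulr1.
split=> -[h1 h2]; apply: DeriveDef.
- by rewrite /derivable -E.
- by rewrite /derive -E.
- by rewrite /derivable E.
- by rewrite /derive E.
Qed.

Lemma is_derive_chain f (k : R -> R) x v (a b : R) :
  is_derive (f x) (1 : R) k b -> is_derive x v f a -> is_derive x v (k \o f) (b * a).
Proof.
move=> hk /is_derive_line hf; apply/is_derive_line.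
apply: (is_derive1_comp (f := k) (g := fun s : R => f (s *: v + x))) => //.
by rewrite scale0r add0r.
Qed.

Lemma C1_of_derive f (f' : V -> V -> R) : continuous f ->
  (forall x v, is_derive x v f (f' v x)) -> (forall v, continuous (f' v)) -> Ck 1 f.
Proof.
move=> cf df cdf; apply/Ck1P; split => // v.
by rewrite (_ : 'D_v f = f' v) //; apply/funext => x; have [_] := df x v.
Qed.

Lemma C1_cst (c : R) : Ck 1 (fun _ : V => c).
Proof.
apply: (@C1_of_derive _ (fun _ _ => 0)) => [|v]; exact: cst_continuous.
Qed.

Lemma C1D f g : Ck 1 f -> Ck 1 g -> Ck 1 (f \+ g).
Proof.
move=> /Ck1P[cf df cdf] /Ck1P[cg dg cdg]; apply/Ck1P; split.
- by move=> x; apply: cvgD; [exact: cf|exact: cg].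
- by move=> x v; exact: derivableD.
- move=> v; rewrite (_ : 'D_v (f \+ g) = fun x => 'D_v f x + 'D_v g x).
    by move=> x; apply: cvgD; [exact: cdf|exact: cdg].
  by apply/funext => x; exact: deriveD.
Qed.

Lemma C1M f g : Ck 1 f -> Ck 1 g -> Ck 1 (f \* g).
Proof.
move=> /Ck1P[cf df cdf] /Ck1P[cg dg cdg]; apply/Ck1P; split.
- by move=> x; apply: cvgM; [exact: cf|exact: cg].
- by move=> x v; exact: derivableM.
- move=> v; rewrite (_ : 'D_v (f \* g) = fun x => f x * 'D_v g x + g x * 'D_v f x).
    by move=> x; apply: cvgD; apply: cvgM; [exact: cf|exact: cdg|exact: cg|exact: cdf].
  by apply/funext => x; exact: deriveM.
Qed.

Lemma C1_comp f (k k' : R -> R) : (forall y : R, is_derive y (1 : R) k (k' y)) ->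
  continuous k' -> Ck 1 f -> Ck 1 (k \o f).
Proof.
move=> dk ck' /Ck1P[cf df cdf].
apply: (@C1_of_derive _ (fun v x => k' (f x) * 'D_v f x)).
- move=> x; apply: continuous_comp; first exact: cf.
  apply: differentiable_continuous; apply/derivable1_diffP.
  by have [] := dk (f x).
- move=> x v; apply: (is_derive_chain (dk _)).
  by apply: DeriveDef => //; exact: df.
- move=> v x; apply: cvgM; last exact: cdf.
  by apply: continuous_comp; [exact: cf|exact: ck'].
Qed.

Lemma C1V f : (forall x, f x != 0) -> Ck 1 f -> Ck 1 (fun x => (f x)^-1).
Proof.
move=> f0 /Ck1P[cf df cdf]; apply/Ck1P; split.
- by move=> x; apply: cvgV; [exact: f0|exact: cf].
- by move=> x v; exact: derivableV.
- move=> v; rewrite (_ : 'D_v _ = fun x => - f x ^- 2 * 'D_v f x).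
    move=> x; apply: cvgM; last exact: cdf.
    apply: cvgN; apply: cvgV; first by rewrite expf_neq0.
    by apply: (@continuous_comp _ _ _ f (fun y => y ^+ 2)); [exact: cf|exact: exprn_continuous].
  by apply/funext => x; exact: deriveV.
Qed.

End C1_functions.

Section bumps.
Context {R : realType}.

(** The square of the positive part is the simplest C^1 function that is
    positive exactly on the positive half-line. *)
Definition psq (y : R) : R := Num.max 0 y ^+ 2.

Lemma psq_ge0 y : 0 <= psq y. Proof. exact: sqr_ge0. Qed.

Lemma psq_gt0 y : (0 < psq y) = (0 < y).
Proof.
rewrite /psq exprn_even_gt0 //=; case: (ltP 0 y) => h; last by rewrite eqxx.
by rewrite gt_eqF.
Qed.

Lemma is_derive_psq (y : R) : is_derive y (1 : R) psq (2 * Num.max 0 y).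
Proof.
apply: (@is_derive_quadratic _ _ _ _ _ _ 1) => h.
rewrite /psq /GRing.scale /= mulr1 mul1r ler_norml.
have [y0|y0] := ltP 0 y; have [z0|z0] := ltP 0 (h + y); rewrite !expr2;
  by apply/andP; split; nra.
Qed.

Lemma continuous_dpsq : continuous (fun y : R => 2 * Num.max 0 y).
Proof.
move=> y; apply: cvgM; first exact: cvg_cst.
by apply: continuous_max; [exact: cvg_cst|exact: cvg_id].
Qed.

Lemma C1_psq (V : normedModType R) (f : V -> R) : Ck 1 f -> Ck 1 (psq \o f).
Proof. exact: (C1_comp is_derive_psq continuous_dpsq). Qed.

Context {d : nat}.
Implicit Types z c : spacetime R d.

Lemma C1_coord i : Ck 1 (fun z => z.1 ord0 i).
Proof.
apply: (@C1_of_derive _ _ (fun z => z.1 ord0 i) (fun v _ => v.1 ord0 i)) => [|x v|v].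
- move=> z; apply: (@continuous_comp _ _ _ fst (fun x : 'rV[R]_d => x ord0 i)).
    exact: cvg_fst.
  exact: coord_continuous.
- apply: (@is_derive_quadratic _ _ _ _ _ _ 0) => h /=.
  by rewrite !mxE mul0r addrK subrr normr0.
- exact: cst_continuous.
Qed.

Lemma C1_time : Ck 1 (fun z => z.2).
Proof.
apply: (@C1_of_derive _ _ (fun z => z.2) (fun v _ => v.2)) => [|x v|v].
- by move=> z; exact: cvg_snd.
- apply: (@is_derive_quadratic _ _ _ _ _ _ 0) => h /=.
  by rewrite mul0r addrK subrr normr0.
- exact: cst_continuous.
Qed.

(** Nothing is normalized: only the set where a bump is positive matters,
    because [1 - 1/(1 + n P)] converges to its indicator. *)
Definition C1_bump (A : set (spacetime R d)) (P : spacetime R d -> R) : Prop :=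
  [/\ Ck 1 P, forall z, 0 <= P z & forall z, 0 < P z <-> A z].

Lemma bumpI A B P Q : C1_bump A P -> C1_bump B Q -> C1_bump (A `&` B) (P \* Q).
Proof.
move=> [cP P0 PA] [cQ Q0 QB]; split => [|z|z]; first exact: C1M.
  exact: mulr_ge0.
split => [h|[/PA ? /QB ?]]; last exact: mulr_gt0.
split; [apply/PA|apply/QB]; rewrite lt_def ?P0 ?Q0 andbT; apply/eqP => e;
  by move: h; rewrite /= e ?mul0r ?mulr0 ltxx.
Qed.

Lemma eq_bump A B P : (forall z, A z <-> B z) -> C1_bump A P -> C1_bump B P.
Proof. by move=> AB [cP P0 PA]; split => // z; rewrite PA. Qed.

Lemma bump_psq (f : spacetime R d -> R) : Ck 1 f ->
  C1_bump [set z : spacetime R d | 0 < f z] (psq \o f).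
Proof.
move=> cf; split => [|z|z]; [exact: C1_psq|exact: psq_ge0|].
by rewrite /= psq_gt0.
Qed.

Lemma bump_coords (F : 'I_d -> spacetime R d -> R) (G : spacetime R d -> R) :
  (forall i, Ck 1 (F i)) -> Ck 1 G ->
  exists P, C1_bump [set z : spacetime R d | (forall i, 0 < F i z) /\ 0 < G z] P.
Proof.
move=> cF cG.
suff [P hP] : exists P, C1_bump [set z : spacetime R d | forall i, i \in enum 'I_d -> 0 < F i z] P.
  exists (P \* (psq \o G)); apply: eq_bump (bumpI hP (bump_psq cG)) => z.
  by split => -[h1 h2]; split => // i; apply: h1; rewrite ?mem_enum.
elim: (enum 'I_d) => [|i s [P hP]].
  exists (fun=> 1); split => [|z|z]; [exact: C1_cst|exact: ler01|].
  by split => // _ i; rewrite in_nil.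
exists ((psq \o F i) \* P); apply: eq_bump (bumpI (bump_psq (cF i)) hP) => z.
split=> [[h1 h2] j|h]; first by rewrite in_cons => /predU1P[->//|/h2].
by split => [|j js]; apply: h; rewrite in_cons ?eqxx ?js ?orbT.
Qed.

Lemma orthant_bump c :
  exists P, C1_bump [set z : spacetime R d | (forall i, c.1 ord0 i < z.1 ord0 i) /\ c.2 < z.2] P.
Proof.
have [|//|P hP] := @bump_coords (fun i z => z.1 ord0 i + (- c.1 ord0 i)) (fun z => z.2 + (- c.2)).
- by move=> i; exact: (C1D (C1_coord i) (C1_cst _)).
- exact: (C1D C1_time (C1_cst _)).
exists P; apply: eq_bump hP => z /=; rewrite subr_gt0.
by split => -[h1 h2]; split => // i; have := h1 i; rewrite subr_gt0.
Qed.

Lemma cball_bump c r : 0 < r ->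
  exists2 P, (exists A, C1_bump A P) &
    (forall z, `|z - c| < r -> 0 < P z) /\ (forall z, 0 < P z -> cball c r z).
Proof.
move=> r0.
have cs (f : spacetime R d -> R) a : Ck 1 f ->
    Ck 1 (fun z => r ^+ 2 + (-1) * ((f z + - a) * (f z + - a))).
  move=> cf; have cfa : Ck 1 (fun z => f z + - a) := C1D cf (C1_cst (- a)).
  exact: (C1D (C1_cst _) (C1M (C1_cst _) (C1M cfa cfa))).
have E (x : R) : (0 < r ^+ 2 + (-1) * (x * x)) = (`|x| < r).
  rewrite mulN1r subr_gt0 -expr2 -[X in X < _]ger0_norm ?sqr_ge0 // normrX.
  by rewrite ltr_pXn2r ?nnegrE ?(ltW r0).
have [P hP] := @bump_coords _ _ (fun i => cs _ (c.1 ord0 i) (C1_coord i)) (cs _ c.2 C1_time).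
exists P; first by eexists; exact: hP.
case: hP => _ _ hP; split => z.
  move=> h; apply/hP; split => [i|]; rewrite E; apply: le_lt_trans h.
    by have := st_coord_le_norm (z - c) i; rewrite !mxE.
  exact: (st_time_le_norm (z - c)).
move=> /hP[h1 h2]; apply/st_norm_le; first exact: ltW.
by split => [i|]; [have := h1 i; rewrite E !mxE => /ltW|have := h2; rewrite E => /ltW].
Qed.

Lemma compact_cball c r : 0 <= r -> compact (cball c r).
Proof.
move=> r0; rewrite cballE //; apply: compact_setX; last exact: segment_compact.
pose A i := `[c.1 ord0 i - r, c.1 ord0 i + r]%classic.
have -> : cbox (fun i => c.1 ord0 i - r) (fun i => c.1 ord0 i + r) =
    [set v : 'rV[R]_d | forall i, A i (v ord0 i)].
  by apply/seteqP; split => x h i; have := h i; rewrite /A /= in_itv.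
by apply: (@rV_compact _ _ A) => i; exact: segment_compact.
Qed.

End bumps.

Section time_derivative.
Context {R : realType} {d : nat}.
Implicit Types (f : spacetime R d -> R) (x : 'rV[R]_d).

Lemma is_derive_time f x (t : R) : Ck 1 f ->
  is_derive t (1 : R) (fun s => f (x, s)) ('D_dir_t f (x, t)).
Proof.
move=> /Ck1P[_ df _].
have E : (fun h : R => h^-1 *: ((f \o shift (x, t)) (h *: dir_t) - f (x, t))) =
  (fun h : R => h^-1 *: (((fun s => f (x, s)) \o shift t) (h *: (1 : R)) - f (x, t))).
  apply/funext => h /=; congr (_ *: (f _ - _)).
  by rewrite /dir_t /= [RHS]surjective_pairing /= -[LHS]/(h *: 0 + x, h *: 1 + t) scaler0 add0r.
apply: DeriveDef; last by rewrite /derive E.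
by rewrite /derivable -E; exact: df.
Qed.

Lemma continuous_slice f x : continuous f -> continuous (fun s : R => f (x, s)).
Proof.
move=> cf t; apply: (@continuous_comp _ _ _ (fun s : R => (x, s))); last exact: cf.
exact: (cvg_pair (cvg_cst x) (@cvg_id _ _)).
Qed.

Lemma FTC_time f x (a b : R) : a < b -> Ck 1 f ->
  \int[lebesgue_measure]_(s in `]a, b[) ('D_dir_t f (x, s)) = f (x, b) - f (x, a).
Proof.
move=> ab cf; have /Ck1P[cf0 _ cdf] := cf.
have cD := @continuous_slice _ x (cdf dir_t).
have cS := @continuous_slice _ x cf0.
have mD (A : set R) : measurable_fun A (fun s => 'D_dir_t f (x, s)).
  by apply: measurable_funTS; exact: continuous_measurable_fun.
rewrite /Rintegral integral_itv_obnd_cbnd; last exact/measurable_EFinP.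
rewrite integral_itv_bndo_bndc; last exact/measurable_EFinP.
rewrite (@continuous_FTC2 _ _ (fun s => f (x, s))) //.
- exact: continuous_subspaceT.
- split => [t _||]; first by have [] := is_derive_time x t cf.
    by apply: cvg_at_right_filter; exact: cS.
  by apply: cvg_at_left_filter; exact: cS.
- by move=> t _; rewrite derive1E; have [_ ->] := is_derive_time x t cf.
Qed.

End time_derivative.

(** * The space-time cylinder *)

Section cylinder.
Context {R : realType} {d : nat} (Omega : set 'rV[R]_d) (T : R).
Hypotheses (oO : open Omega) (bO : bounded_set Omega).
Local Notation Q := (cylinder Omega T).

Lemma open_cylinder : open Q.
Proof.
have -> : Q = (fst @^-1` Omega) `&` (snd @^-1` `]0, T[) by [].
apply: openI; apply: open_comp => //.
- by move=> z _; exact: cvg_fst.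
- by move=> z _; exact: cvg_snd.
Qed.

Lemma measurable_cylinder : measurable (Q : set (mst R d)).
Proof. exact: open_measurable_st open_cylinder. Qed.

Lemma cylinder_bounded : exists2 M, 0 <= M & Q `<=` cball 0 M.
Proof.
have [M [_ hM]] := bO.
exists (Num.max (Num.max (M + 1) `|T|) 0); first by rewrite le_max lexx orbT.
move=> -[x t] [/= Ox]; rewrite in_itv /= => /andP[t0 tT].
rewrite /cball /= subr0 prod_normE /= ge_max; apply/andP; split.
  by rewrite !le_max (hM (M + 1) _ x) // ltrDl.
by rewrite !le_max (ger0_norm (ltW t0)) (le_trans (ltW tT) (ler_norm T)) orbT.
Qed.

Lemma domain_bounded : exists2 M, 0 <= M & forall x, Omega x -> `|x| <= M.
Proof.
have [M [_ hM]] := bO; exists (Num.max (M + 1) 0); first by rewrite le_max lexx orbT.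
by move=> x Ox; rewrite le_max (hM (M + 1) _ x) // ltrDl.
Qed.

Lemma cylinder_fin : (lebesgue_st (Q : set (mst R d)) < +oo)%E.
Proof.
have [M M0 QM] := cylinder_bounded.
apply: (@le_lt_trans _ _ (lebesgue_st (cball 0 M : set (mst R d)))); last first.
  by rewrite lebesgue_st_cball // ltry.
apply: le_measure => //; rewrite inE; first exact: measurable_cylinder.
exact: measurable_cball.
Qed.

Lemma domain_fin : (lebesgue_rV d Omega < +oo)%E.
Proof.
have [M M0 OM] := domain_bounded.
apply: (@le_lt_trans _ _ (lebesgue_rV d (cbox (fun=> - M) (fun=> M)))); last first.
  by rewrite lebesgue_rV_cbox ?ltry // => i; lra.
apply: le_measure => //; rewrite ?inE; [exact: open_measurable_rV|exact: measurable_cbox|].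
move=> x /OM h i; rewrite -ler_norml; exact: le_trans (coord_le_norm _ _) h.
Qed.

Lemma continuous_bounded_on_ball (f : spacetime R d -> R) M : continuous f -> 0 <= M ->
  exists C, forall z, cball 0 M z -> `|f z| <= C.
Proof.
move=> cf M0.
have : compact (f @` cball 0 M).
  by apply: continuous_compact; [exact: continuous_subspaceT|exact: compact_cball].
move=> /compact_bounded[C [_ hC]]; exists (C + 1) => z hz.
by apply: (hC (C + 1)); rewrite ?ltrDl //; exists z.
Qed.

Lemma continuous_L2_cylinder (f : spacetime R d -> R) : continuous f ->
  L2 lebesgue_st (Q : set (mst R d)) f.
Proof.
move=> cf; have [M M0 QM] := cylinder_bounded.
have [C hC] := continuous_bounded_on_ball cf M0.
have mf : measurable_fun (Q : set (mst R d)) f.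
  by apply: measurable_funTS; exact: continuous_measurable_st.
by apply: (L2_bounded measurable_cylinder mf cylinder_fin (M := C)) => x /QM/hC.
Qed.

Lemma measurable_slice_x (f : spacetime R d -> R) (t : R) : continuous f ->
  measurable_fun [set: 'rV[R]_d] (fun x => f (x, t)).
Proof.
move=> cf; have mf := continuous_measurable_st cf.
have mp : measurable_fun [set: 'rV[R]_d] (fun x : 'rV[R]_d => (x, t) : mst R d).
  by apply: measurable_fun_pair => //; exact: measurable_cst.
exact: (measurableT_comp mf mp).
Qed.

Lemma continuous_L2_domain (f : spacetime R d -> R) (t : R) : continuous f ->
  L2 (lebesgue_rV d) Omega (fun x => f (x, t)).
Proof.
move=> cf; have [M M0 OM] := domain_bounded.
have M'0 : 0 <= Num.max M `|t| by rewrite le_max M0.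
have [C hC] := continuous_bounded_on_ball cf M'0.
have mf : measurable_fun Omega (fun x => f (x, t)).
  by apply: measurable_funTS; exact: measurable_slice_x.
apply: (L2_bounded (open_measurable_rV oO) mf domain_fin (M := C)) => x /OM h.
apply: hC; rewrite /cball /= subr0 prod_normE /= ge_max !le_max h /=.
by rewrite lexx orbT.
Qed.

End cylinder.

(** * The fundamental lemma of the calculus of variations *)

Section orthants.
Context {R : realType} {d : nat}.

Definition orthant (c : spacetime R d) : set (spacetime R d) :=
  [set z : spacetime R d | (forall i, c.1 ord0 i < z.1 ord0 i) /\ c.2 < z.2].

(** A pi-system, each member of which is the positivity set of a C^1
    function. *)
Definition orthants : set (set (mst R d)) := range orthant.

Lemma setI_closed_orthants : setI_closed orthants.
Proof.
move=> A B [a _ <-] [b _ <-].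
exists (\row_i Num.max (a.1 ord0 i) (b.1 ord0 i), Num.max a.2 b.2) => //.
apply/seteqP; split => z; rewrite /orthant /=.
  move=> [h]; rewrite gt_max => /andP[h1 h2]; do !split => //;
  by move=> i; have := h i; rewrite mxE gt_max => /andP[].
move=> [[h1 h2] [h3 h4]]; split => [i|]; rewrite ?mxE gt_max ?h1 ?h3 //.
by rewrite h2 h4.
Qed.

Lemma orthant_open c :
  open (orthant c).
Proof.
have [P [cP P0 hP]] := orthant_bump c.
have -> : orthant c = P @^-1` [set y | 0 < y] by apply/seteqP; split => z /hP.
apply: open_comp; last exact: open_gt.
by move=> z _; have /Ck1P[+ _ _] := cP; apply.
Qed.

(** A half-space bounded by a coordinate hyperplane is a countable union of
    orthants. *)
Lemma measurable_orthants : @measurable _ (mst R d) = <<s orthants >>.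
Proof.
apply/seteqP; split; last first.
  apply: smallest_sub; first exact: sigma_algebra_measurable.
  by move=> A [c _ <-]; exact: (open_measurable_st (@orthant_open c)).
pose S : measurableType _ := g_sigma_algebraType orthants.
have half (O : nat -> set (mst R d)) (A : set (mst R d)) :
    (forall k, orthants (O k)) -> A = \bigcup_k O k ->
    measurable (A : set S).
  move=> hO ->; apply: bigcupT_measurable => k; exact: sub_sigma_algebra.
have low (z : spacetime R d) : exists k : nat,
    (forall i, - k%:R < z.1 ord0 i) /\ - k%:R < z.2.
  exists (Num.truncn `|z|).+1; have h := truncnS_gt `|z|.
  split => [i|]; rewrite ltrNl.
    apply: le_lt_trans h; apply: le_trans (st_coord_le_norm z i).
    by rewrite -normrN ler_norm.
  by apply: le_lt_trans h; apply: le_trans (st_time_le_norm z); rewrite -normrN ler_norm.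
have m1 : measurable_fun [set: S] (fun z : S => (z : mst R d).1).
  apply: measurable_fun_rV => i.
  apply: (measurability _ (RGenOInfty.measurableE R)) => _ [_ [a ->] <-].
  rewrite setTI; pose c k : spacetime R d :=
    (\row_j (if j == i then a else - k%:R), - k%:R).
  apply: (half (orthant \o c)); first by move=> k; exists (c k).
  apply/seteqP; split => z /=; rewrite /orthant /= in_itv /= andbT.
    move=> az; have [k [h1 h2]] := low z; exists k => //; split => // j.
    by rewrite mxE; case: eqP => [->|].
  by move=> [k _ [/(_ i) + _]]; rewrite mxE eqxx.
have m2 : measurable_fun [set: S] (fun z : S => (z : mst R d).2).
  apply: (measurability _ (RGenOInfty.measurableE R)) => _ [_ [a ->] <-].
  rewrite setTI; pose c k : spacetime R d := (\row_j (- k%:R), a).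
  apply: (half (orthant \o c)); first by move=> k; exists (c k).
  apply/seteqP; split => z /=; rewrite /orthant /= in_itv /= andbT.
    by move=> az; have [k [h1 h2]] := low z; exists k => //; split => // j; rewrite mxE.
  by move=> [k _ []].
move=> A mA; have := measurable_fun_pair m1 m2 measurableT mA.
rewrite setTI (_ : _ @^-1` A = A) //; apply/seteqP; split => -[x t] //.
Qed.

End orthants.

Lemma negligible_bigcup_countType {disp} {X : measurableType disp} {R : realType}
    (mu : {measure set X -> \bar R}) (I : countType) (F : I -> set X) :
  (forall i, mu.-negligible (F i)) -> mu.-negligible (\bigcup_i F i).
Proof.
move=> nF; pose G n := if unpickle n is Some i then F i else set0.
have nG n : mu.-negligible (G n).
  by rewrite /G; case: unpickle => [i|]; [exact: nF|exact: negligible_set0].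
apply: negligibleS (negligible_bigcup nG) => x [i _ Fx].
by exists (pickle i) => //; rewrite /G pickleK.
Qed.

Section fundamental_lemma.
Context {R : realType} {d : nat}.
Local Notation mu := (@lebesgue_st R d).
Variables (Q : set (spacetime R d)) (g : spacetime R d -> R).
Hypotheses (oQ : open Q) (finQ : (mu (Q : set (mst R d)) < +oo)%E).
Hypothesis L2g : L2 mu (Q : set (mst R d)) g.
Hypothesis g_orth : forall phi, test_function 1 Q phi -> inner Q g phi = 0.

Let mQ : measurable (Q : set (mst R d)) := open_measurable_st oQ.

Let int_g : mu.-integrable (Q : set (mst R d)) (EFin \o g).
Proof. exact: (L2_integrable mQ finQ L2g). Qed.

Let cvg_inv1D (y : R) : 0 < y -> (1 + n.+1%:R * y)^-1 @[n --> \oo] --> (0 : R).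
Proof.
move=> y0; apply: (@squeeze_cvgr _ _ _ _ (cst 0) (fun n => y^-1 * n.+1%:R^-1)).
- apply: nearW => n; have h : 0 < n.+1%:R * y by rewrite mulr_gt0.
  rewrite invr_ge0 addr_ge0 ?(ltW h) //= -invfM lef_pV2 ?posrE ?mulr_gt0 ?addr_gt0 //.
  by rewrite mulrC lerDr.
- exact: cvg_cst.
- rewrite -(mulr0 y^-1); apply: cvgM; first exact: cvg_cst.
  exact: cvg_harmonic.
Qed.

(** The bumps [1 - 1/(1 + n P P')] are test functions; they increase to the
    indicator of the set where both [P] and [P'] are positive. *)
Let integral_bump (c : spacetime R d) (r : R) A P B P' :
  0 < r -> cball c r `<=` Q -> (forall z, 0 < P z -> cball c r z) ->
  C1_bump A P -> C1_bump B P' ->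
  (\int[mu]_(z in (A `&` B : set (mst R d))) (g z)%:E = 0)%E.
Proof.
move=> r0 cQ Pc bP bP'; have [cPP PP0 PPpos] := bumpI bP bP'.
have [_ P0 _] := bP; have [_ P'0 _] := bP'.
have cPPc : continuous (P \* P') by have /Ck1P[] := cPP.
have ABQ : A `&` B `<=` Q.
  move=> z /PPpos /= h; apply: cQ; apply: Pc; rewrite lt_def P0 andbT.
  by apply/eqP => e; move: h; rewrite e mul0r ltxx.
have den n z : 0 < 1 + n.+1%:R * (P z * P' z).
  by rewrite ltr_pwDl ?mulr_ge0.
pose phi n (z : spacetime R d) := 1 + (-1) * (1 + n.+1%:R * (P z * P' z))^-1.
have cphi n : Ck 1 (phi n).
  apply: C1D; [exact: C1_cst|apply: C1M; first exact: C1_cst].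
  apply: C1V => [x|]; first by rewrite gt_eqF.
  by apply: C1D; [exact: C1_cst|apply: C1M; first exact: C1_cst].
have phi01 n z : `|phi n z| <= 1.
  rewrite /phi; have h := den n z; have hi : 0 < (1 + n.+1%:R * (P z * P' z))^-1 by rewrite invr_gt0.
  have : (1 + n.+1%:R * (P z * P' z))^-1 <= 1.
    by rewrite invf_le1 // lerDl !mulr_ge0.
  by rewrite ler_norml => ?; apply/andP; split; lra.
have tphi n : test_function 1 Q (phi n).
  have supp : closure [set z | phi n z != 0] `<=` cball c r.
    have cl : closed (cball c r) by apply: compact_closed; [exact: norm_hausdorff|by apply: compact_cball; exact: ltW].
    rewrite closureE => z; apply; split => // w /= h; apply: Pc.
    rewrite lt_def P0 andbT; apply/eqP => e; move/eqP: h; apply.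
    by rewrite /phi e mul0r mulr0 addr0 invr1 mulr1 subrr.
  split; [exact: cphi| |exact: subset_trans supp cQ].
  apply: (@subclosed_compact _ _ (cball c r)) => //; first exact: closed_closure.
  by apply: compact_cball; exact: ltW.
have mphi n (D : set (mst R d)) : measurable_fun D (phi n).
  by apply: measurable_funTS; apply: continuous_measurable_st; have /Ck1P[] := cphi n.
have int0 n : (\int[mu]_(z in (Q : set (mst R d))) (g z * phi n z)%:E = 0)%E.
  have L2phi : L2 mu (Q : set (mst R d)) (phi n).
    by apply: (L2_bounded mQ _ finQ (M := 1)).
  have := g_orth (tphi n); rewrite /inner /Rintegral => h.
  by rewrite -[LHS]fineK ?h //; apply: integrable_fin_num => //; exact: L2_integrableM.
have mAB : measurable (A `&` B : set (mst R d)).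
  apply: open_measurable_st.
  have -> : A `&` B = (P \* P') @^-1` [set y | 0 < y] by apply/seteqP; split => z /PPpos.
  by apply: open_comp; [move=> z _; exact: cPPc|exact: open_gt].
have mg : measurable_fun (Q : set (mst R d)) g by case: L2g.
rewrite -[X in (\int[_]_(_ in X) _ = _)%E](setIidr ABQ) integral_mkcondr.
have mf_ n : measurable_fun (Q : set (mst R d)) (fun z => (g z * phi n z)%:E).
  by apply/measurable_EFinP; exact: measurable_funM.
have mf : measurable_fun (Q : set (mst R d)) ((EFin \o g) \_ (A `&` B)).
  apply: (measurable_restrict _ mAB mQ).1; apply/measurable_EFinP.
  by apply: measurable_funS mg => //; exact: subIsetl.
have f_f : {ae mu, forall z, Q z -> (g z * phi n z)%:E @[n --> \oo] --> ((EFin \o g) \_ (A `&` B)) z}.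
  apply: aeW => z Qz; rewrite patchE; case: ifPn => hz.
    have /PPpos pz : (A `&` B) z by exact: set_mem hz.
    apply/fine_cvgP; split; first exact: nearW.
    rewrite [X in _ --> X](_ : _ = g z * (1 + (-1) * 0)); last by rewrite mulr0 addr0 mulr1.
    apply: cvgM; first exact: cvg_cst.
    apply: cvgD; first exact: cvg_cst.
    apply: cvgM; first exact: cvg_cst.
    exact: cvg_inv1D.
  have e0 : P z * P' z = 0.
    apply/eqP; rewrite eq_le (PP0 z) andbT leNgt; apply/negP => /PPpos h.
    by move: hz; rewrite mem_set.
  rewrite [X in X @ _](_ : _ = cst 0%E); first exact: cvg_cst.
  by apply/funext => n; rewrite /phi e0 mulr0 addr0 invr1 mulr1 subrr mulr0.
have f_g : {ae mu, forall z, forall n, Q z -> (`|(g z * phi n z)%:E| <= `|g z|%:E)%E}.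
  apply: aeW => z n Qz; rewrite lee_fin normrM.
  by rewrite -[leRHS]mulr1 ler_wpM2l.
have [_ _ H] := dominated_convergence mQ mf_ mf f_f (integrable_norm int_g) f_g.
have : [sequence (\int[mu]_(z in (Q : set (mst R d))) (g z * phi n z)%:E)%E]_n @ \oo --> 0%E.
  by rewrite (_ : [sequence _]_n = cst 0%E); [exact: cvg_cst|apply/funext => n; exact: int0].
by move=> H0; rewrite -(cvg_lim _ H0) // -(cvg_lim _ H).
Qed.

(** Dynkin's lemma passes from orthants to all measurable sets. *)
Let ae_zero_on (c : spacetime R d) (r : R) A P :
  0 < r -> cball c r `<=` Q -> (forall z, 0 < P z -> cball c r z) ->
  C1_bump A P -> mu.-negligible (A `&` [set z | g z != 0] : set (mst R d)).
Proof.
move=> r0 cQ Pc bP; have [cP P0 Ppos] := bP.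
have mA : measurable (A : set (mst R d)).
  apply: open_measurable_st.
  have -> : A = P @^-1` [set y | 0 < y] by apply/seteqP; split => z /Ppos.
  by apply: open_comp; [move=> z _; have /Ck1P[+ _ _] := cP; apply|exact: open_gt].
have AQ : A `<=` Q by move=> z /Ppos/Pc/cQ.
have intA (S : set (mst R d)) : measurable S -> mu.-integrable (A `&` S) (EFin \o g).
  move=> mS; apply: integrableS int_g => //; first exact: measurableI.
  by move=> z [/AQ].
have zero (S : set (mst R d)) : measurable S ->
    (\int[mu]_(z in (A `&` S : set (mst R d))) (g z)%:E = 0)%E.
  move=> mS; move: (mS); rewrite [X in X S]measurable_orthants => oS.
  apply: (dynkin_induction measurable_orthants (@setI_closed_orthants R d)
    (P := fun S => (\int[mu]_(z in (A `&` S : set (mst R d))) (g z)%:E = 0)%E) _ _ _ _ oS).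
  - apply: (integral_bump r0 cQ Pc bP (P' := fun=> 1)).
    by split => [|z|z]; [exact: C1_cst|exact: ler01|split].
  - move=> _ [a _ <-]; have [P' bP'] := orthant_bump a.
    exact: (integral_bump r0 cQ Pc bP bP').
  - move=> B mB B0.
    have AT : (\int[mu]_(z in (A : set (mst R d))) (g z)%:E = 0)%E.
      rewrite -[X in (\int[_]_(_ in X) _)%E]setIT.
      apply: (integral_bump r0 cQ Pc bP (P' := fun=> 1)).
      by split => [|z|z]; [exact: C1_cst|exact: ler01|split].
    have : (\int[mu]_(z in ((A `&` B) `|` (A `&` ~` B) : set (mst R d))) (g z)%:E = 0)%E.
      by rewrite -setIUr setUv setIT.
    rewrite integral_setU_EFin //.
    + by rewrite B0 add0e.
    + exact: measurableI.
    + by apply: measurableI => //; exact: measurableC.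
    + rewrite -setIUr setUv setIT; apply: measurable_funS (mQ) _ _ => //.
      by case: L2g.
    + by apply/disj_setPS => z [[_ ?] [_]].
  - move=> F mF tF F0; rewrite setI_bigcupr integral_bigcup.
    + by rewrite eseries0 // => n _ _; exact: F0.
    + exact: trivIset_setIl.
    + by move=> k; exact: (measurableI _ _ mA (mF k)).
    + rewrite -setI_bigcupr; apply: intA; exact: bigcupT_measurable.
have : ae_eq mu (A : set (mst R d)) (EFin \o g) (cst 0%E).
  apply: integral_ae_eq => //.
  - by rewrite -[X in _.-integrable X]setIT; exact: intA.
  - move=> E EA mE; rewrite integral0 -(setIidr EA); exact: zero.
move=> [N [mN N0 hN]]; exists N; split => // z [Az gz]; apply: hN => /= h.
by have [] := h Az => e; move: gz; rewrite /= e eqxx.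
Qed.

(** An open set is a countable union of balls whose closures it contains, so
    that the local result suffices. *)
Lemma orthogonal_to_test_functions_ae0 :
  ae_eq mu (Q : set (mst R d)) (EFin \o g) (cst 0%E).
Proof.
pose N (i : ({ffun 'I_d -> rat} * rat) * nat) : set (mst R d) :=
  if `[< cball (rat_point i.1 : spacetime R d) i.2.+1%:R^-1 `<=` Q >]
  then [set z | `|(z : spacetime R d) - rat_point i.1| < i.2.+1%:R^-1] `&` [set z | g z != 0]
  else set0.
suff : mu.-negligible (\bigcup_i N i).
  apply: negligibleS => z /= /not_implyP[Qz /eqP gz].
  have [q [k [h1 h2]]] := open_rat_cball oQ Qz.
  exists (q, k) => //; rewrite /N asboolT //; split => //=.
apply: negligible_bigcup_countType => i; rewrite /N.
case: asboolP => [sub|_]; last exact: negligible_set0.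
have r0 : 0 < i.2.+1%:R^-1 :> R by rewrite invr_gt0.
have [P [A bP] [hP1 hP2]] := @cball_bump R d (rat_point i.1) _ r0.
apply: negligibleS (ae_zero_on r0 sub hP2 bP) => z [h1 h2]; split => //.
by case: bP => _ _ <-; exact: hP1.
Qed.

End fundamental_lemma.

Lemma cvg_nrm_sqr {R : realType} {disp} {X : measurableType disp}
    (mu : {measure set X -> \bar R}) (D : set X) (f : nat -> X -> R) g :
  (\int[mu]_(x in D) (f n x - g x) ^+ 2) @[n --> \oo] --> (0 : R) <->
  nrm mu D (f n \- g) @[n --> \oo] --> (0 : R).
Proof.
have E n : \int[mu]_(x in D) (f n x - g x) ^+ 2 = nrm mu D (f n \- g) ^+ 2.
  by rewrite sqr_nrm; apply: eq_Rintegral => x _; rewrite expr2.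
split=> h.
  rewrite (_ : (fun n => nrm mu D (f n \- g)) =
      fun n => Num.sqrt (\int[mu]_(x in D) (f n x - g x) ^+ 2)).
    rewrite -[X in _ --> X]sqrtr0.
    by apply: (@continuous_cvg _ _ _ _ _ _ Num.sqrt) => //; exact: sqrt_continuous.
  by apply/funext => n; rewrite E sqrtr_sqr ger0_norm ?nrm_ge0.
under eq_fun do rewrite E expr2.
by rewrite -(mulr0 (0 : R)); exact: cvgM.
Qed.

(** * Integration over time slices *)

Section fubini.
Context {R : realType} {d : nat} (Omega : set 'rV[R]_d) (T : R).
Hypotheses (oO : open Omega) (bO : bounded_set Omega) (T0 : 0 < T).
Local Notation Q := (cylinder Omega T).
Local Notation mu := (@lebesgue_st R d).
Local Notation nu := (lebesgue_rV d).
Local Notation leb := (@lebesgue_measure R).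

Let mQ : measurable (Q : set (mst R d)) := measurable_cylinder T oO.
Let mO : measurable Omega := open_measurable_rV oO.

Let finQ : (mu (Q : set (mst R d)) < +oo)%E := cylinder_fin T oO bO.
Let mI : measurable (`]0, T[%classic : set (measurableTypeR R)) := measurable_itv _.

Let leb_time : leb `]0, T[%classic = T%:E.
Proof.
by apply: etrans (lebesgue_measure_itv _) _; rewrite /= lte_fin T0 -EFinD subr0.
Qed.

Let leb_time_fin : (leb `]0%R, T[%classic < +oo)%E.
Proof. by rewrite leb_time ltry. Qed.

Let fubini_patch (f : spacetime R d -> \bar R) (x : 'rV[R]_d) :
  fubini_F leb ((f : mst R d -> \bar R) \_ Q) x =
  ((fun x => \int[leb]_(s in `]0%R, T[) f (x, s))%E \_ Omega) x.
Proof.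
rewrite /fubini_F patchE; case: ifPn => xO.
  rewrite [RHS]integral_mkcond; apply: eq_integral => s _ /=.
  rewrite !patchE; congr (if _ then _ else _).
  by apply/idP/idP => /set_mem h; apply/mem_set => //; [case: h|split => //; exact: set_mem xO].
rewrite (_ : (fun y => _) = cst 0%E) ?integral0 //.
apply/funext => s; rewrite patchE memNset // => -[xO' _].
by move: xO; rewrite mem_set.
Qed.

Lemma fubini_cylinder (f : spacetime R d -> R) :
  mu.-integrable (Q : set (mst R d)) (EFin \o f) ->
  (\int[mu]_(z in (Q : set (mst R d))) (f z)%:E =
   \int[nu]_(x in Omega) \int[leb]_(s in `]0%R, T[) (f (x, s))%:E)%E /\
  {ae nu, forall x, Omega x -> leb.-integrable `]0, T[ (fun s => (f (x, s))%:E)}.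
Proof.
rewrite /lebesgue_st; have [m' ->] := @lebesgue_rV_sigma_finite R d.
move=> /(integrable_mkcond _ mQ).1 intf; split.
  rewrite [LHS]integral_mkcond -(integral12_prod_meas1 intf) [RHS]integral_mkcond.
  by apply: eq_integral => x _; rewrite fubini_patch.
apply: filterS (ae_integrable1 intf) => x /= h xO.
apply: (integrable_mkcond _ mI).2; apply: eq_integrable h => // s _ /=.
rewrite !patchE; congr (if _ then _ else _).
by apply/idP/idP => /set_mem h; apply/mem_set => //; case: h.
Qed.

Lemma tonelli_cylinder (f : spacetime R d -> R) :
  measurable_fun (Q : set (mst R d)) f -> (forall z, 0 <= f z) ->
  (\int[mu]_(z in (Q : set (mst R d))) (f z)%:E =
   \int[nu]_(x in Omega) \int[leb]_(s in `]0%R, T[) (f (x, s))%:E)%E /\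
  measurable_fun Omega (fun x => \int[leb]_(s in `]0%R, T[) (f (x, s))%:E)%E.
Proof.
move=> mf f0; rewrite /lebesgue_st; have [m' ->] := @lebesgue_rV_sigma_finite R d.
have mfQ : measurable_fun [set: mst R d] ((EFin \o f) \_ Q).
  have mEf : measurable_fun (Q : set (mst R d)) (EFin \o f) by exact/measurable_EFinP.
  exact: ((measurable_restrictT _ mQ).1 mEf).
have fQ0 z : (0 <= ((EFin \o f : mst R d -> \bar R) \_ Q) z)%E.
  by rewrite patchE; case: ifP => // _; rewrite lee_fin.
split.
  rewrite [LHS]integral_mkcond (fubini_tonelli1 _ mfQ fQ0) [RHS]integral_mkcond.
  by apply: eq_integral => x _; rewrite fubini_patch.
pose G x := (\int[leb]_(s in `]0%R, T[) (f (x, s))%:E)%E.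
apply: (measurable_restrictT G mO).2.
have -> : G \_ Omega =
    fubini_F leb ((EFin \o f : mst R d -> \bar R) \_ Q).
  by apply/funext => x; rewrite fubini_patch.
exact: (@measurable_fun_fubini_tonelli_F _ _ _ _ _ leb _ mfQ fQ0).
Qed.

Lemma measurable_slice_t (f : spacetime R d -> R) x : Omega x ->
  measurable_fun (Q : set (mst R d)) f -> measurable_fun `]0, T[ (fun s => f (x, s)).
Proof.
move=> xO mf.
have mfQ : measurable_fun [set: mst R d] (f \_ Q) by apply: (measurable_restrictT _ mQ).1.
have mp : measurable_fun [set: measurableTypeR R] (fun s : measurableTypeR R => (x, s) : mst R d).
  by apply: measurable_fun_pair => //; exact: measurable_cst.
have := measurable_funTS (D := `]0, T[%classic) (measurableT_comp mfQ mp).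
apply: eq_measurable_fun => s; rewrite inE => hs /=; rewrite patchE mem_set //.
Qed.

Definition time_integral (f : spacetime R d -> R) (x : 'rV[R]_d) : R :=
  \int[leb]_(s in `]0, T[) f (x, s).

(** Cauchy-Schwarz on each time slice; the inequality holds for every slice
    because its right-hand side is infinite on the exceptional ones. *)
Let time_integral_sqr (f : spacetime R d -> R) x : Omega x ->
  measurable_fun (Q : set (mst R d)) f ->
  (((time_integral f x) ^+ 2)%:E <=
    T%:E * \int[leb]_(s in `]0%R, T[) (f (x, s) ^+ 2)%:E)%E.
Proof.
move=> xO mf; have mfx := measurable_slice_t xO mf.
set I := (\int[leb]_(s in _) _)%E.
have I0 : (0 <= I)%E by apply: integral_ge0 => s _; rewrite lee_fin sqr_ge0.
have [Ifin|] := ltP I +oo%E; last first.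
  by rewrite leye_eq => /eqP ->; rewrite gt0_muley ?lte_fin // leey.
have L2f : L2 leb `]0, T[ (fun s => f (x, s)).
  split => //; apply/integrableP; split.
    by apply/measurable_EFinP; exact: measurable_funX.
  by under eq_integral do rewrite /= ger0_norm ?sqr_ge0 //.
have L21 : L2 leb `]0, T[ (fun=> 1).
  apply: (L2_bounded mI _ leb_time_fin (M := 1)); first exact: measurable_cst.
  by move=> ? _; rewrite normr1.
have := Cauchy_Schwarz mI L2f L21.
rewrite /ip (_ : \int[leb]_(s in _) (f (x, s) * 1) = time_integral f x); last first.
  by apply: eq_Rintegral => s _; rewrite mulr1.
have e1 : nrm leb `]0, T[ (fun=> 1) = Num.sqrt T.
  rewrite /nrm /ip (Rintegral_cst _ mI) !mul1r; congr Num.sqrt.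
  exact: (congr1 fine leb_time).
have e2 : (nrm leb `]0, T[ (fun s => f (x, s)) ^+ 2)%:E = I.
  rewrite sqr_nrm /ip /Rintegral fineK; first by [].
  by rewrite ge0_fin_numE // integral_ge0 // => s _; rewrite lee_fin -expr2 sqr_ge0.
rewrite e1 => h; rewrite -e2 -EFinM lee_fin -[leLHS]ger0_norm ?sqr_ge0 // normrX.
rewrite -[X in X * _](sqr_sqrtr (ltW T0)) -exprMn mulrC lerXn2r ?nnegrE //.
by rewrite mulr_ge0 ?nrm_ge0 ?sqrtr_ge0.
Qed.

Lemma time_integral_L2 (f : spacetime R d -> R) :
  L2 mu (Q : set (mst R d)) f ->
  L2 nu Omega (time_integral f) /\
  nrm nu Omega (time_integral f) <= Num.sqrt T * nrm mu (Q : set (mst R d)) f.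
Proof.
move=> L2f; have [mf f2] := L2f.
have [e mF] := tonelli_cylinder (measurable_funX 2 mf) (fun z => sqr_ge0 (f z)).
have intf := L2_integrable mQ finQ L2f.
have mJ : measurable_fun Omega (time_integral f).
  apply: (measurable_restrictT (time_integral f) mO).2.
  have := (integrable_mkcond _ mQ).1 intf.
  rewrite /lebesgue_st; have [m' ->] := @lebesgue_rV_sigma_finite R d.
  move=> /measurable_fubini_F mfub.
  have -> : time_integral f \_ Omega =
      fine \o fubini_F leb ((EFin \o f : mst R d -> \bar R) \_ Q).
    apply/funext => x /=; rewrite (fubini_patch (EFin \o f)) !patchE.
    by case: ifP.
  exact: measurableT_comp (@fine_measurable R _ measurableT) mfub.
have le : (\int[nu]_(x in Omega) ((time_integral f x) ^+ 2)%:E <=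
    T%:E * \int[mu]_(z in (Q : set (mst R d))) (f z ^+ 2)%:E)%E.
  rewrite e -ge0_integralZl //; last 2 first.
  - by move=> x _; apply: integral_ge0 => s _; rewrite lee_fin sqr_ge0.
  - by rewrite lee_fin ltW.
  apply: ge0_le_integral => //.
  - by move=> x _; rewrite lee_fin sqr_ge0.
  - by apply/measurable_EFinP; exact: measurable_funX.
  - by apply: measurable_funeM.
  - by move=> x xO; exact: time_integral_sqr.
have fin2 : (\int[mu]_(z in (Q : set (mst R d))) (f z ^+ 2)%:E)%E \is a fin_num.
  exact: integrable_fin_num.
have L2J : L2 nu Omega (time_integral f).
  split => //; apply/integrableP; split; first by apply/measurable_EFinP; exact: measurable_funX.
  under eq_integral do rewrite /= ger0_norm ?sqr_ge0 //.
  by apply: le_lt_trans le _; rewrite -(fineK fin2) -EFinM ltry.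
split => //; rewrite -sqrtrM ?(ltW T0) //; apply: ler_wsqrtr.
have finJ : (\int[nu]_(x in Omega) ((time_integral f x) ^+ 2)%:E)%E \is a fin_num.
  by apply: integrable_fin_num => //; case: L2J.
rewrite -lee_fin EFinM /ip /Rintegral.
move: le; rewrite -(fineK finJ) -(fineK fin2).
by under eq_integral do rewrite expr2; under [X in (_ * (fine X)%:E)%E]eq_integral do rewrite expr2.
Qed.

(** Only almost everywhere: on exceptional slices the integrals are
    meaningless. *)
Lemma time_integralB (f g : spacetime R d -> R) :
  L2 mu (Q : set (mst R d)) f -> L2 mu (Q : set (mst R d)) g ->
  {ae nu, forall x, Omega x ->
    time_integral (f \- g) x = time_integral f x - time_integral g x}.
Proof.
move=> hf hg.
have [_ af] := fubini_cylinder (L2_integrable mQ finQ hf); have [_ ag] := fubini_cylinder (L2_integrable mQ finQ hg).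
by apply: filterS2 af ag => x h1 h2 xO; apply: RintegralB; [exact: measurable_itv|exact: h1|exact: h2].
Qed.

Lemma divergence_time F : Ck 1 F ->
  \int[mu]_(z in (Q : set (mst R d))) ('D_dir_t F z) =
  \int[nu]_(x in Omega) (F (x, T) - F (x, 0)).
Proof.
move=> cF; have /Ck1P[_ _ cD] := cF.
have intD := L2_integrable mQ finQ (continuous_L2_cylinder T oO bO (cD dir_t)).
have [e ae1] := fubini_cylinder intD.
congr fine; rewrite [LHS]e; apply: eq_integral => x xO.
rewrite -(FTC_time x T0 cF) /Rintegral fineK //.
have mDx : measurable_fun `]0, T[ (fun s => 'D_dir_t F (x, s)).
  by apply: measurable_funTS; apply: continuous_measurable_fun; exact: continuous_slice (cD _).
apply: integrable_fin_num => //.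
have [M M0 QM] := cylinder_bounded T bO.
have [C hC] := continuous_bounded_on_ball (cD dir_t) M0.
apply: (@le_integrable _ _ _ _ _ mI _ (cst C%:E)).
- exact/measurable_EFinP.
- move=> s hs; rewrite /= lee_fin; apply: le_trans (ler_norm C).
  by apply: hC; apply: QM; split => //; exact: set_mem xO.
- apply/integrableP; split; first exact: measurable_cst.
  by rewrite integral_cst //; apply: lte_mul_pinfty.
Qed.

End fubini.

(** * Weak time derivatives and traces *)

Lemma squeeze_cvg0 {R : realType} (f g : nat -> R) :
  (forall n, 0 <= f n <= g n) -> g n @[n --> \oo] --> (0 : R) ->
  f n @[n --> \oo] --> (0 : R).
Proof.
move=> h cg; apply: (@squeeze_cvgr _ _ _ _ (fun=> 0) g) => //; last exact: cvg_cst.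
by apply: nearW => n; exact: h.
Qed.

Lemma cvgD0 {R : realType} (f g : nat -> R) :
  f n @[n --> \oo] --> (0 : R) -> g n @[n --> \oo] --> (0 : R) ->
  (f n + g n) @[n --> \oo] --> (0 : R).
Proof. by move=> cf cg; rewrite -(addr0 (0 : R)); exact: cvgD. Qed.

Lemma cvgZ0 {R : realType} (c : R) (f : nat -> R) :
  f n @[n --> \oo] --> (0 : R) -> (c * f n) @[n --> \oo] --> (0 : R).
Proof. by move=> cf; rewrite -(mulr0 c); apply: cvgM => //; exact: cvg_cst. Qed.

Section weak_derivatives.
Context {R : realType} {d : nat}.
Local Notation mu := (@lebesgue_st R d).
Implicit Types (D : set (spacetime R d)) (u g : spacetime R d -> R).

Lemma wd_L2 D e u : measurable (D : set (mst R d)) ->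
  L2 mu (D : set (mst R d)) (wd D e u).
Proof.
move=> mD; have [h|h] := pselect (has_wd D e u); first by have [] := xgetPex (fun=> 0) h.
rewrite /wd xgetPN; first exact: L2_0.
by move=> g hg; apply: h; exists g.
Qed.

Lemma wdP D e u : has_wd D e u -> weak_derivative D e u (wd D e u).
Proof. by move=> h; have [] := xgetPex (fun=> 0) h. Qed.

Lemma wlap_L2 D u : measurable (D : set (mst R d)) ->
  L2 mu (D : set (mst R d)) (wlap D u).
Proof.
move=> mD; have [h|h] := pselect (has_wlap D u); first by have [] := xgetPex (fun=> 0) h.
rewrite /wlap xgetPN; first exact: L2_0.
by move=> g hg; apply: h; exists g.
Qed.

End weak_derivatives.

Section traces.
Context {R : realType} {d : nat} (Omega : set 'rV[R]_d) (T : R).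
Hypotheses (oO : open Omega) (bO : bounded_set Omega) (T0 : 0 < T).
Local Notation Q := (cylinder Omega T).
Local Notation mu := (@lebesgue_st R d).
Local Notation nu := (lebesgue_rV d).
Local Notation dt := (weak_dt Omega T).
Implicit Types u v : spacetime R d -> R.

Let mQ : measurable (Q : set (mst R d)) := measurable_cylinder T oO.
Let mO : measurable Omega := open_measurable_rV oO.

Let L2cont (f : spacetime R d -> R) : continuous f -> L2 mu (Q : set (mst R d)) f.
Proof. exact: continuous_L2_cylinder. Qed.

Let Ck1_cont (f : spacetime R d -> R) : Ck 1 f -> continuous f.
Proof. by case/Ck1P. Qed.

Let Ck1_contD (f : spacetime R d -> R) e : Ck 1 f -> continuous ('D_e f).
Proof. by case/Ck1P. Qed.

Lemma dt_L2 u : L2 mu (Q : set (mst R d)) (dt u).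
Proof. exact: wd_L2. Qed.

(** Weak derivatives are unique almost everywhere, hence additive. *)
Lemma wd_additive e u v : L2 mu (Q : set (mst R d)) u -> L2 mu (Q : set (mst R d)) v ->
  has_wd Q e u -> has_wd Q e v ->
  nrm mu (Q : set (mst R d)) ((wd Q e u \+ wd Q e v) \- wd Q e (u \+ v)) = 0.
Proof.
move=> hu hv wu wv.
have Lu := wd_L2 e u mQ; have Lv := wd_L2 e v mQ.
have wuv : weak_derivative Q e (u \+ v) (wd Q e u \+ wd Q e v).
  move=> phi tphi; have [cphi _ _] := tphi.
  have Lphi := L2cont (Ck1_cont cphi); have LD := L2cont (Ck1_contD (e := e) cphi).
  have := wdP wv tphi; have := wdP wu tphi; rewrite /inner => e1 e2.
  have := ipDl mQ hu hv LD; have := ipDl mQ Lu Lv Lphi; rewrite /ip => -> ->.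
  by rewrite e1 e2 opprD.
have hw : has_wd Q e (u \+ v) by exists (wd Q e u \+ wd Q e v); split => //; exact: L2D.
have Lw := wd_L2 e (u \+ v) mQ.
have L0 := L2B mQ (L2D mQ Lu Lv) Lw.
have ae0 : ae_eq mu (Q : set (mst R d))
    (EFin \o ((wd Q e u \+ wd Q e v) \- wd Q e (u \+ v))) (EFin \o (fun=> 0)).
  apply: (orthogonal_to_test_functions_ae0 (open_cylinder (T := T) oO) (cylinder_fin T oO bO) L0).
  move=> phi tphi; have [cphi _ _] := tphi; have Lphi := L2cont (Ck1_cont cphi).
  have := ipBl mQ (L2D mQ Lu Lv) Lw Lphi; rewrite /inner /ip => ->.
  have := wuv _ tphi; have := wdP hw tphi; rewrite /inner => -> /oppr_inj ->.
  by rewrite subrr.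
rewrite (nrm_ae_eq mQ L0 (L2_0 _ _) ae0).
rewrite /nrm /ip (_ : \int[mu]_(x in _) _ = 0) ?sqrtr0 //.
by rewrite (Rintegral_cst _ mQ) !mul0r.
Qed.

Lemma is_time_trace_add tau u v g h :
  L2 mu (Q : set (mst R d)) u -> L2 mu (Q : set (mst R d)) v ->
  has_wd Q dir_t u -> has_wd Q dir_t v ->
  is_time_trace Omega T tau u g -> is_time_trace Omega T tau v h ->
  is_time_trace Omega T tau (u \+ v) (g \+ h).
Proof.
move=> hu hv wu wv [Lg [phi [c1 c2 c3 c4]]] [Lh [psi [e1 e2 e3 e4]]].
split; first exact: L2D.
exists (fun n => phi n \+ psi n); split.
- by move=> n; exact: C1D.
- apply: (@squeeze_cvg0 _ _ (fun n => nrm mu (Q : set (mst R d)) (phi n \- u) +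
     nrm mu (Q : set (mst R d)) (psi n \- v))).
  + move=> n; rewrite sqrtr_ge0 /=.
    have := ler_nrmD mQ (L2B mQ (L2cont (Ck1_cont (c1 n))) hu)
      (L2B mQ (L2cont (Ck1_cont (e1 n))) hv).
    rewrite (_ : (phi n \- u) \+ (psi n \- v) = (phi n \+ psi n) \- (u \+ v)) //.
    by apply/funext => z /=; ring.
  + exact: (cvgD0 c2 e2).
- apply: (@squeeze_cvg0 _ _ (fun n =>
     nrm mu (Q : set (mst R d)) ('D_dir_t (phi n) \- dt u) +
     nrm mu (Q : set (mst R d)) ('D_dir_t (psi n) \- dt v))).
  + move=> n; rewrite sqrtr_ge0 /=.
    have Lp := L2cont (Ck1_contD (e := dir_t) (c1 n)); have Ls := L2cont (Ck1_contD (e := dir_t) (e1 n)).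
    have L1 := L2B mQ Lp (dt_L2 u); have L2' := L2B mQ Ls (dt_L2 v).
    have L3 := L2B mQ (L2D mQ (dt_L2 u) (dt_L2 v)) (dt_L2 (u \+ v)).
    apply: le_trans (ler_nrmD mQ L1 L2'); rewrite -[leRHS]addr0.
    rewrite -(wd_additive hu hv wu wv).
    apply: le_trans (ler_nrmD mQ (L2D mQ L1 L2') L3); rewrite le_eqVlt.
    apply/orP; left; apply/eqP; rewrite /normL2 /norm2 /inner /nrm /ip.
    congr Num.sqrt; apply: eq_Rintegral => z _.
    have -> : 'D_dir_t (phi n \+ psi n) = 'D_dir_t (phi n) \+ 'D_dir_t (psi n).
      by apply/funext => y; apply: deriveD; [have /Ck1P[_ + _] := c1 n|have /Ck1P[_ + _] := e1 n]; apply.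
    by rewrite /=; ring.
  + exact: (cvgD0 c3 e3).
- apply/cvg_nrm_sqr; move/cvg_nrm_sqr in c4; move/cvg_nrm_sqr in e4.
  apply: (@squeeze_cvg0 _ _ (fun n =>
     nrm nu Omega ((fun x => phi n (x, tau)) \- g) + nrm nu Omega ((fun x => psi n (x, tau)) \- h))).
  + move=> n; rewrite nrm_ge0 /=.
    have Lp := continuous_L2_domain oO bO tau (Ck1_cont (c1 n)).
    have Ls := continuous_L2_domain oO bO tau (Ck1_cont (e1 n)).
    have := ler_nrmD mO (L2B mO Lp Lg) (L2B mO Ls Lh).
    apply: le_trans; rewrite le_eqVlt; apply/orP; left; apply/eqP; congr nrm.
    by apply/funext => z /=; ring.
  + exact: (cvgD0 c4 e4).
Qed.

(** The fundamental theorem of calculus expresses the final values of the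
    approximating C^1 functions by their initial values and their time
    derivatives, both of which converge. *)
Lemma final_trace_exists u : is_time_trace Omega T 0 u (fun=> 0) ->
  is_time_trace Omega T T u (time_integral T (dt u)).
Proof.
move=> [_ [phi [c1 c2 c3 c4]]].
have [LJ _] := time_integral_L2 oO bO T0 (dt_L2 u).
split => //; exists phi; split => //.
apply/cvg_nrm_sqr; move/cvg_nrm_sqr in c4.
apply: (@squeeze_cvg0 _ _ (fun n =>
   nrm nu Omega ((fun x => phi n (x, 0)) \- (fun=> 0)) +
   Num.sqrt T * nrm mu (Q : set (mst R d)) ('D_dir_t (phi n) \- dt u))).
- move=> n; rewrite nrm_ge0 /=.
  have Lp0 := continuous_L2_domain oO bO 0 (Ck1_cont (c1 n)).
  have LpT := continuous_L2_domain oO bO T (Ck1_cont (c1 n)).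
  have LD := L2cont (Ck1_contD (e := dir_t) (c1 n)).
  have [LB leB] := time_integral_L2 oO bO T0 (L2B mQ LD (dt_L2 u)).
  apply: (@le_trans _ _ (nrm nu Omega (((fun x => phi n (x, 0)) \- (fun=> 0)) \+
     time_integral T ('D_dir_t (phi n) \- dt u)))); last first.
    apply: le_trans (ler_nrmD mO _ LB) _; first exact: L2B (L2_0 _ _).
    by rewrite lerD2l.
  rewrite le_eqVlt; apply/orP; left; apply/eqP; apply: nrm_ae_eq => //.
  + exact: L2B.
  + by apply: L2D => //; exact: L2B (L2_0 _ _).
  + apply: filterS (time_integralB oO bO LD (dt_L2 u)) => x h xO /=.
    rewrite h // [time_integral T ('D_dir_t _) x](FTC_time x T0 (c1 n)).
    by congr EFin; ring.
- exact: (cvgD0 c4 (cvgZ0 _ c3)).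
Qed.

(** The weight removes the boundary term at the other end of the time interval,
    so that the approximating sequences of a single trace suffice. *)
Let weighted_green_C1 tau tau' phi psi :
  (tau = T /\ tau' = 0) \/ (tau = 0 /\ tau' = T) -> Ck 1 phi -> Ck 1 psi ->
  T * ip nu Omega (fun x => phi (x, tau)) (fun x => psi (x, tau)) =
  ip mu (Q : set (mst R d)) phi psi +
  ip mu (Q : set (mst R d)) ('D_dir_t phi) (fun z => (z.2 - tau') * psi z) +
  ip mu (Q : set (mst R d)) (fun z => (z.2 - tau') * phi z) ('D_dir_t psi).
Proof.
move=> tt cphi cpsi.
pose l (z : spacetime R d) := z.2 + - tau'.
have cl : Ck 1 l by apply: C1D; [exact: C1_time|exact: C1_cst].
have cF : Ck 1 (l \* (phi \* psi)) := (C1M cl (C1M cphi cpsi)).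
have D1 : continuous (fun z => l z * psi z) := Ck1_cont (C1M cl cpsi).
have D2 : continuous (fun z => l z * phi z) := Ck1_cont (C1M cl cphi).
have dl z : 'D_dir_t l z = 1.
  have : is_derive z dir_t l 1.
    apply: (@is_derive_quadratic _ _ _ _ _ _ 0) => h.
    rewrite (_ : l (h *: dir_t + z) - l z - h * 1 = 0) ?normr0 ?mul0r //.
    by rewrite /l /dir_t /= /GRing.scale /=; ring.
  by case.
have der (f : spacetime R d -> R) z : Ck 1 f -> derivable f z dir_t by case/Ck1P.
have DF z : 'D_dir_t (l \* (phi \* psi)) z =
    (phi z * psi z + 'D_dir_t phi z * (l z * psi z)) + (l z * phi z) * 'D_dir_t psi z.
  rewrite (deriveM (f := l) (g := phi \* psi)); [|exact: der cl|exact: der (C1M cphi cpsi)].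
  rewrite (deriveM (f := phi) (g := psi)); [|exact: der cphi|exact: der cpsi].
  by rewrite dl /GRing.scale /=; ring.
have Lphi := L2cont (Ck1_cont cphi); have Lpsi := L2cont (Ck1_cont cpsi).
have LDphi := L2cont (Ck1_contD (e := dir_t) cphi); have LDpsi := L2cont (Ck1_contD (e := dir_t) cpsi).
have i1 := L2_integrableM mQ Lphi Lpsi.
have i2 := L2_integrableM mQ LDphi (L2cont D1).
have i3 := L2_integrableM mQ (L2cont D2) LDpsi.
have := divergence_time oO bO T0 cF.
have -> : \int[mu]_(z in (Q : set (mst R d))) 'D_dir_t (l \* (phi \* psi)) z =
    \int[mu]_(z in (Q : set (mst R d))) ((phi z * psi z + 'D_dir_t phi z * (l z * psi z)) +
      (l z * phi z) * 'D_dir_t psi z).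
  by apply: eq_Rintegral => z _; exact: DF.
rewrite (RintegralD mQ (integrableD mQ i1 i2) i3) (RintegralD mQ i1 i2) => e.
transitivity (\int[nu]_(x in Omega)
  ((l \* (phi \* psi)) (x, T) - (l \* (phi \* psi)) (x, 0))); last by rewrite -e.
have Lf f (cf : Ck 1 f) := continuous_L2_domain oO bO tau (Ck1_cont cf).
rewrite /ip -(RintegralZl T mO (L2_integrableM mO (Lf _ cphi) (Lf _ cpsi))).
apply: eq_Rintegral => x _; rewrite /l /=.
by case: tt => -[-> ->]; ring.
Qed.

Let weight_bound tau' (z : mst R d) : tau' = 0 \/ tau' = T -> Q z -> `|z.2 - tau'| <= T.
Proof.
move=> ht [_]; rewrite /= in_itv /= => /andP[h1 h2].
by rewrite ler_norml; apply/andP; split; case: ht => ->; lra.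
Qed.

Let weighted_green tau tau' u v g h :
  (tau = T /\ tau' = 0) \/ (tau = 0 /\ tau' = T) ->
  L2 mu (Q : set (mst R d)) u -> L2 mu (Q : set (mst R d)) v ->
  is_time_trace Omega T tau u g -> is_time_trace Omega T tau v h ->
  T * ip nu Omega g h =
  ip mu (Q : set (mst R d)) u v +
  ip mu (Q : set (mst R d)) (dt u) (fun z => (z.2 - tau') * v z) +
  ip mu (Q : set (mst R d)) (fun z => (z.2 - tau') * u z) (dt v).
Proof.
move=> tt hu hv [Lg [phi [c1 c2 c3 c4]]] [Lh [psi [e1 e2 e3 e4]]].
move/cvg_nrm_sqr in c4; move/cvg_nrm_sqr in e4.
have ht : tau' = 0 \/ tau' = T by case: tt => -[_ ->]; [left|right].
pose w (z : spacetime R d) := z.2 - tau'.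
have cw : continuous w.
  exact: (Ck1_cont (C1D C1_time (C1_cst (- tau')))).
have mw (D : set (mst R d)) : measurable_fun D w.
  by apply: measurable_funTS; exact: continuous_measurable_st.
have wb (z : mst R d) : Q z -> `|w z| <= T by exact: weight_bound.
have Lw f : L2 mu (Q : set (mst R d)) f -> L2 mu (Q : set (mst R d)) (fun z => w z * f z).
  exact: (L2Mbounded mQ (mw _) wb).
have cvgw (f : nat -> spacetime R d -> R) f0 : (forall n, L2 mu (Q : set (mst R d)) (f n)) ->
    L2 mu (Q : set (mst R d)) f0 ->
    nrm mu (Q : set (mst R d)) (f n \- f0) @[n --> \oo] --> (0 : R) ->
    nrm mu (Q : set (mst R d)) ((fun z => w z * f n z) \- (fun z => w z * f0 z)) @[n --> \oo] --> (0 : R).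
  move=> Lf Lf0 cf; apply: (@squeeze_cvg0 _ _ (fun n => T * nrm mu (Q : set (mst R d)) (f n \- f0))).
  - move=> n; rewrite nrm_ge0 /=.
    rewrite (_ : _ \- _ = fun z => w z * (f n \- f0) z); last by apply/funext => z /=; ring.
    exact: (ler_nrmMbounded mQ (mw _) (ltW T0) wb (L2B mQ (Lf n) Lf0)).
  - exact: (cvgZ0 _ cf).
have Lphi n := L2cont (Ck1_cont (c1 n)); have Lpsi n := L2cont (Ck1_cont (e1 n)).
have LDphi n := L2cont (Ck1_contD (e := dir_t) (c1 n)); have LDpsi n := L2cont (Ck1_contD (e := dir_t) (e1 n)).
have Lt (f : spacetime R d -> R) (cf : Ck 1 f) := continuous_L2_domain oO bO tau (Ck1_cont cf).
have lhs := cvg_nrm_ip mO (fun n => Lt _ (c1 n)) (fun n => Lt _ (e1 n)) Lg Lh c4 e4.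
have r1 := cvg_nrm_ip mQ Lphi Lpsi hu hv c2 e2.
have r2 := cvg_nrm_ip mQ LDphi (fun n => Lw _ (Lpsi n)) (dt_L2 u) (Lw _ hv) c3 (cvgw _ _ Lpsi hv e2).
have r3 := cvg_nrm_ip mQ (fun n => Lw _ (Lphi n)) LDpsi (Lw _ hu) (dt_L2 v) (cvgw _ _ Lphi hu c2) e3.
have R3 : ip mu (Q : set (mst R d)) (phi n) (psi n) +
    ip mu (Q : set (mst R d)) ('D_dir_t (phi n)) (fun z => w z * psi n z) +
    ip mu (Q : set (mst R d)) (fun z => w z * phi n z) ('D_dir_t (psi n)) @[n --> \oo] -->
    ip mu (Q : set (mst R d)) u v + ip mu (Q : set (mst R d)) (dt u) (fun z => w z * v z) +
    ip mu (Q : set (mst R d)) (fun z => w z * u z) (dt v).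
  by apply: cvgD r3; exact: cvgD r1 r2.
have L3 : T * ip nu Omega (fun x => phi n (x, tau)) (fun x => psi n (x, tau))
    @[n --> \oo] --> T * ip nu Omega g h.
  by apply: cvgM lhs; exact: cvg_cst.
rewrite -[LHS](cvg_lim (@Rhausdorff R) L3) -[RHS](cvg_lim (@Rhausdorff R) R3).
congr (lim (_ @ \oo)); apply/funext => n.
exact: (weighted_green_C1 tt (c1 n) (e1 n)).
Qed.

(** The identity with weight [t - T] at the initial time is subtracted from that
    with weight [t] at the final time: the weights differ by the constant [T]. *)
Lemma integration_by_parts_time u v :
  L2 mu (Q : set (mst R d)) u -> L2 mu (Q : set (mst R d)) v ->
  is_time_trace Omega T 0 u (fun=> 0) -> is_time_trace Omega T 0 v (fun=> 0) ->
  [/\ L2 nu Omega (time_trace Omega T T u), L2 nu Omega (time_trace Omega T T v) &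
  ip mu (Q : set (mst R d)) (dt u) v + ip mu (Q : set (mst R d)) u (dt v) =
  ip nu Omega (time_trace Omega T T u) (time_trace Omega T T v)].
Proof.
move=> hu hv tu tv.
have Tu : is_time_trace Omega T T u (time_trace Omega T T u).
  exact: (xgetPex (fun=> 0) (ex_intro _ _ (final_trace_exists tu))).
have Tv : is_time_trace Omega T T v (time_trace Omega T T v).
  exact: (xgetPex (fun=> 0) (ex_intro _ _ (final_trace_exists tv))).
split; [by case: Tu|by case: Tv|].
have eT := weighted_green (or_introl (conj erefl erefl)) hu hv Tu Tv.
have e0 := weighted_green (or_intror (conj erefl erefl)) hu hv tu tv.
have z0 : ip nu Omega (fun=> 0) (fun=> 0) = 0 :> R.
  by rewrite /ip (Rintegral_cst _ mO) !mul0r.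
have wL (tau' : R) f : tau' = 0 \/ tau' = T -> L2 mu (Q : set (mst R d)) f ->
    L2 mu (Q : set (mst R d)) (fun z => (z.2 - tau') * f z).
  move=> ht; apply: (L2Mbounded mQ _ (fun z => weight_bound ht)).
  apply: measurable_funTS; apply: continuous_measurable_st.
  exact: (Ck1_cont (C1D C1_time (C1_cst (- tau')))).
have E f h : L2 mu (Q : set (mst R d)) f -> L2 mu (Q : set (mst R d)) h ->
    ip mu (Q : set (mst R d)) (fun z => (z.2 - 0) * f z) h -
    ip mu (Q : set (mst R d)) (fun z => (z.2 - T) * f z) h = T * ip mu (Q : set (mst R d)) f h.
  move=> Lf Lh; rewrite -ipBl //; [|by apply: wL => //; left|by apply: wL => //; right].
  by rewrite -ipZl //; congr ip; apply/funext => z /=; ring.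
rewrite z0 mulr0 in e0.
have E1 := E _ _ hu (dt_L2 v); have E2 := E _ _ hv (dt_L2 u).
rewrite !(ipC mu _ _ (dt u)) in E2.
have arith (a b c x0 y0 xT yT l : R) : 0 = c + x0 + y0 -> l = c + xT + yT ->
    yT - y0 = T * b -> xT - x0 = T * a -> T * (a + b) = l.
  by move=> h -> h1 h2; lra.
by apply: (mulfI (lt0r_neq0 T0)); exact: (arith _ _ _ _ _ _ _ _ e0 eT E1 E2).
Qed.

End traces.

(** * Spline functions: measurability and Lipschitz pieces *)

Lemma measurable_invr {R : realType} : measurable_fun [set: R] (@GRing.inv R).
Proof.
rewrite -(setvU [set 0]); apply/measurable_funU; [exact: measurableC|by []|split].
  apply: open_continuous_measurable_fun; first by apply: closed_openC; exact: closed_eq.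
  by move=> x; rewrite inE /= => /eqP x0; exact: inv_continuous.
exact: measurable_fun_set1.
Qed.

Section elementary_functions.
Context {R : realType} {n : nat}.
Implicit Types f g : 'rV[R]_n -> R.

(** The operations from which rational and truncated hierarchical B-splines are
    built: measurability and Lipschitz pieces then follow by induction. *)
Inductive elementary : ('rV[R]_n -> R) -> Prop :=
| elementary_cst c : elementary (fun=> c)
| elementary_coord j : elementary (fun xi => xi ord0 j)
| elementary_step j a b : elementary (fun xi => if a <= xi ord0 j < b then 1 else 0)
| elementaryD f g : elementary f -> elementary g -> elementary (fun xi => f xi + g xi)
| elementaryM f g : elementary f -> elementary g -> elementary (fun xi => f xi * g xi)
| elementaryV f : elementary f -> elementary (fun xi => (f xi)^-1).

Lemma elementary_sum (I : Type) (s : seq I) (F : I -> 'rV[R]_n -> R) :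
  (forall i, elementary (F i)) -> elementary (fun xi => \sum_(i <- s) F i xi).
Proof.
move=> hF; elim: s => [|i s IH].
  by under eq_fun do rewrite big_nil; exact: elementary_cst.
by under eq_fun do rewrite big_cons; exact: elementaryD.
Qed.

Lemma elementary_prod (I : Type) (s : seq I) (F : I -> 'rV[R]_n -> R) :
  (forall i, elementary (F i)) -> elementary (fun xi => \prod_(i <- s) F i xi).
Proof.
move=> hF; elim: s => [|i s IH].
  by under eq_fun do rewrite big_nil; exact: elementary_cst.
by under eq_fun do rewrite big_cons; exact: elementaryM.
Qed.

Lemma elementary_fsum (I : choiceType) (A : set I) (F : I -> 'rV[R]_n -> R) :
  finite_set A -> (forall i, elementary (F i)) ->
  elementary (fun xi => \sum_(i \in A) F i xi).
Proof.
move=> fA hF; under eq_fun do rewrite fsbig_finite //.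
exact: elementary_sum.
Qed.

Lemma elementary_bspline (k : seq R) p i j :
  elementary (fun xi => bspline k p i (xi ord0 j)).
Proof.
elim: p i => [|q IH] i /=; first exact: elementary_step.
apply: elementaryD; apply: elementaryM => //; apply: elementaryM; try exact: elementary_cst.
  by apply: elementaryD; [exact: elementary_coord|exact: elementary_cst].
apply: elementaryD; first exact: elementary_cst.
under eq_fun do rewrite -mulN1r.
by apply: elementaryM; [exact: elementary_cst|exact: elementary_coord].
Qed.

Lemma finite_multi_index p (k : 'I_n -> seq R) : finite_set (multi_index p k).
Proof.
pose N := (\max_j size (k j))%N.
apply: (@sub_finite_set _ _ ((fun f : {ffun 'I_n -> 'I_N.+1} =>
    [ffun j => nat_of_ord (f j)]) @` setT)); last exact/finite_image/finite_finset.
move=> i hi; exists [ffun j => inord (i j)] => //; apply/ffunP => j.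
rewrite !ffunE inordK // ltnS; apply: leq_trans (leq_bigmax j).
exact: leq_trans (leq_addr _ _) (ltnW (hi j)).
Qed.

Variables (p : nat) (S : spline_data R n).

Lemma elementary_tensor l i : elementary (tensor_bspline p (knots S l) i).
Proof. by apply: elementary_prod => j; exact: elementary_bspline. Qed.

Lemma elementary_thb l g : thb_basis p S l g -> elementary g.
Proof.
elim: l g => [|m IH] g /=; first by move=> [i _ <-]; exact: elementary_tensor.
move=> [[f [_ _ [c [_ ->]]]]|[[i _ <-] _]]; last exact: elementary_tensor.
apply: elementary_fsum => [|i].
  by apply: finite_setIl; exact: finite_multi_index.
by apply: elementaryM; [exact: elementary_cst|exact: elementary_tensor].
Qed.

Lemma spline_space_elementary s : spline_space p S s ->
  exists2 F, elementary F & forall xi, cube xi -> s xi = F xi.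
Proof.
move=> [m [c [g [hg hs]]]].
exists (fun xi => (\sum_(a < m) c a * g a xi) / weight_function p S xi) => //.
apply: elementaryM.
  apply: elementary_sum => a; apply: elementaryM; first exact: elementary_cst.
  exact: elementary_thb (hg a).
apply: elementaryV; apply: elementary_fsum => [|i]; first exact: finite_multi_index.
by apply: elementaryM; [exact: elementary_cst|exact: elementary_tensor].
Qed.

Lemma measurable_elementary f : elementary f -> measurable_fun [set: 'rV[R]_n] f.
Proof.
elim=> [c|j|j a b|f1 f2 _ m1 _ m2|f1 f2 _ m1 _ m2|f1 _ m1].
- exact: measurable_cst.
- exact: measurable_coord.
- apply: measurable_fun_ifT; [|exact: measurable_cst|exact: measurable_cst].
  apply: (measurable_and (f := fun xi : 'rV[R]_n => a <= xi ord0 j)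
    (g := fun xi : 'rV[R]_n => xi ord0 j < b)).
    by apply: measurable_fun_ler; [exact: measurable_cst|exact: measurable_coord].
  by apply: measurable_fun_ltr; [exact: measurable_coord|exact: measurable_cst].
- exact: measurable_funD.
- exact: measurable_funM.
- exact: (measurableT_comp measurable_invr m1).
Qed.

End elementary_functions.

Section countably_Lipschitz.
Context {R : realType} {n : nat}.
Implicit Types f g : 'rV[R]_n -> R.

Definition bounded_lipschitz (A : set 'rV[R]_n) f (M : R) : Prop :=
  forall x y, A x -> A y -> `|f x| <= M /\ `|f x - f y| <= M * `|x - y|.

(** No continuity is asked between the pieces, so that step functions belong to
    the class; countably many pieces are needed for inverses, and they do no
    harm to null sets. *)
Definition countably_lipschitz f : Prop :=
  exists A : nat -> set 'rV[R]_n, cube `<=` \bigcup_i A i /\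
    forall i, exists M, bounded_lipschitz (A i) f M.

Lemma countably_lipschitz_countType (J : countType) (A : J -> set 'rV[R]_n) f :
  cube `<=` \bigcup_i A i -> (forall i, exists M, bounded_lipschitz (A i) f M) ->
  countably_lipschitz f.
Proof.
move=> cA lA; exists (fun k => if unpickle k is Some i then A i else set0); split.
  by move=> x /cA[i _ Ai]; exists (pickle i) => //; rewrite pickleK.
by move=> k; case: unpickle => [i|]; [exact: lA|exists 0 => x y []].
Qed.

Lemma countably_lipschitz_op2 (op : R -> R -> R) f g :
  (forall M1 M2 : R, 0 <= M1 -> 0 <= M2 -> exists2 M : R, 0 <= M & forall a b a' b' : R,
    `|a| <= M1 -> `|b| <= M2 -> `|a'| <= M1 -> `|b'| <= M2 ->
    `|op a b| <= M /\ `|op a b - op a' b'| <= M * (`|a - a'| + `|b - b'|)) ->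
  countably_lipschitz f -> countably_lipschitz g ->
  countably_lipschitz (fun xi => op (f xi) (g xi)).
Proof.
move=> hop [A [cA lA]] [B [cB lB]].
apply: (@countably_lipschitz_countType _ (fun ij : nat * nat => A ij.1 `&` B ij.2)).
  by move=> x hx; have [i _ Ai] := cA x hx; have [j _ Bj] := cB x hx; exists (i, j).
move=> [i j] /=; have [M1 l1] := lA i; have [M2 l2] := lB j.
have [e|] := pselect (exists x, (A i `&` B j) x); last first.
  by move=> ne; exists 0 => x y hx; exfalso; apply: ne; exists x.
case: e => x0 [Ax0 Bx0].
have M10 : 0 <= M1 by have [h _] := l1 _ _ Ax0 Ax0; exact: le_trans h.
have M20 : 0 <= M2 by have [h _] := l2 _ _ Bx0 Bx0; exact: le_trans h.
have [M M0 hM] := hop _ _ M10 M20.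
exists (Num.max M (M * (M1 + M2))) => x y [Ax Bx] [Ay By].
have [fx fxy] := l1 _ _ Ax Ay; have [gx gxy] := l2 _ _ Bx By.
have [fy _] := l1 _ _ Ay Ay; have [gy _] := l2 _ _ By By.
have [h1 h2] := hM _ _ _ _ fx gx fy gy; split; first by rewrite le_max h1.
apply: le_trans h2 _; apply: (@le_trans _ _ (M * (M1 + M2) * `|x - y|)).
  by rewrite -mulrA mulrDl ler_wpM2l // lerD.
by rewrite ler_wpM2r // le_max lexx orbT.
Qed.

Lemma countably_lipschitz_elementary f : elementary f -> countably_lipschitz f.
Proof.
elim=> [c|j|j a b|f1 f2 _ l1 _ l2|f1 f2 _ l1 _ l2|g _ [A [cA lA]]].
- exists (fun=> setT); split; first by move=> x _; exists 0%N.
  by move=> _; exists `|c| => x y _ _; rewrite subrr normr0 mulr_ge0.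
- exists (fun=> cube); split; first by move=> x hx; exists 0%N.
  move=> _; exists 1 => x y /(_ j)/andP[x0 x1] _; split.
    by rewrite ger0_norm ltW.
  by rewrite mul1r; have := coord_le_norm (x - y) j; rewrite !mxE.
- pose B (i : bool) : set 'rV[R]_n := [set xi | (a <= xi ord0 j < b) = i].
  apply: (@countably_lipschitz_countType _ B).
    by move=> x _; exists (a <= x ord0 j < b).
  move=> i; exists 1 => x y; rewrite /B /= => -> ->; rewrite subrr normr0 mul1r normr_ge0.
  by case: (i); rewrite ?normr1 ?normr0.
- apply: (countably_lipschitz_op2 (op := +%R)) l1 l2 => M1 M2 M10 M20.
  exists (M1 + M2 + 1); first by lra.
  move=> x y x' y' hx hy _ _; split.
    by apply: le_trans (ler_normD _ _) _; lra.
  rewrite opprD addrACA; apply: le_trans (ler_normD _ _) _.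
  by rewrite ler_peMl ?addr_ge0 //; lra.
- apply: (countably_lipschitz_op2 (op := *%R)) l1 l2 => M1 M2 M10 M20.
  exists (M1 * M2 + M1 + M2); first by rewrite !addr_ge0 // mulr_ge0.
  move=> x y x' y' hx hy hx' hy'; split.
    rewrite normrM -addrA; apply: le_trans (ler_pM _ _ hx hy) _ => //.
    by rewrite lerDl addr_ge0.
  rewrite (_ : x * y - x' * y' = x * (y - y') + y' * (x - x')); last by ring.
  apply: le_trans (ler_normD _ _) _; rewrite !normrM.
  have := ler_wpM2r (normr_ge0 (y - y')) hx; have := ler_wpM2r (normr_ge0 (x - x')) hy'.
  have := mulr_ge0 M10 (normr_ge0 (x - x')); have := mulr_ge0 M20 (normr_ge0 (y - y')).
  have := mulr_ge0 (mulr_ge0 M10 M20) (addr_ge0 (normr_ge0 (x - x')) (normr_ge0 (y - y'))).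
  move: `|x| `|y'| `|x - x'| `|y - y'| => u v w z; lra.
- pose B (i : nat * nat) : set 'rV[R]_n := A i.1 `&`
    [set x | if i.2 is k.+1 then k.+1%:R^-1 <= `|g x| else g x = 0].
  apply: (@countably_lipschitz_countType _ B).
    move=> x hx; have [i _ Ai] := cA x hx.
    have [g0|g0] := eqVneq (g x) 0; first by exists (i, 0%N).
    have : 0 < `|g x| by rewrite normr_gt0.
    move=> /ltr_add_invr[k]; rewrite add0r => hk.
    by exists (i, k.+1) => //; split => //=; exact: ltW.
  move=> [i [|k]]; have [M l] := lA i.
    exists 0 => x y [_ /= ->] [_ /= ->].
    by rewrite subrr invr0 normr0 mul0r.
  have k0 : 0 < k.+1%:R :> R by [].
  exists (Num.max k.+1%:R (M * k.+1%:R ^+ 2)) => x y [Ax /= gx] [Ay /= gy].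
  have [_ lxy] := l _ _ Ax Ay.
  have inv z : k.+1%:R^-1 <= `|g z| -> 0 < `|g z| /\ `|g z|^-1 <= k.+1%:R.
    move=> h; have p0 : 0 < `|g z| by apply: lt_le_trans h; rewrite invr_gt0.
    by split => //; rewrite -[leRHS]invrK lef_pV2 ?posrE ?invr_gt0.
  have [px ix] := inv _ gx; have [py iy] := inv _ gy.
  split; first by rewrite normfV le_max ix.
  have nx : g x != 0 by rewrite -normr_gt0.
  have ny : g y != 0 by rewrite -normr_gt0.
  have -> : (g x)^-1 - (g y)^-1 = (g x)^-1 * (g y)^-1 * (g y - g x) by field; rewrite ?nx ?ny.
  rewrite !normrM !normfV (distrC (g y)).
  apply: (@le_trans _ _ (k.+1%:R ^+ 2 * (M * `|x - y|))).
    by rewrite expr2; apply: ler_pM => //; rewrite ?mulr_ge0 ?invr_ge0 //; apply: ler_pM; rewrite ?invr_ge0.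
  by rewrite mulrA (mulrC _ M) ler_wpM2r // le_max lexx orbT.
Qed.

End countably_Lipschitz.

(** * Null images of hyperplanes *)

Lemma finite_union_le {disp} {X : measurableType disp} {R : realType}
    (mu : {measure set X -> \bar R}) (I : finType) (B : I -> set X) (e : R) :
  (forall i, measurable (B i)) -> (forall i, (mu (B i) <= e%:E)%E) ->
  (mu (\big[setU/set0]_i B i) <= (#|I|%:R * e)%:E)%E.
Proof.
move=> mB Be; rewrite cardE -big_enum /=.
elim: (enum I) => [|i s IH]; first by rewrite big_nil measure0 mul0r.
rewrite big_cons /= -natr1 mulrDl mul1r addrC EFinD.
apply: (@le_trans _ _ (mu (B i) + mu (\big[setU/set0]_(j <- s) B j))%E).
  by apply: measureU2 => //; exact: bigsetU_measurable.
exact: leeD.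
Qed.

Section hyperplanes.
Context {R : realType} {d : nat}.
Local Notation mu := (@lebesgue_st R d).

(** A grid of mesh [1/N] on a hyperplane has [N^d] cells, whose images lie in
    balls of measure [O(N^-(d+1))]. *)
Lemma Lipschitz_hyperplane_negligible (A : set 'rV[R]_d.+1) j (c M : R)
    (Phi : 'rV[R]_d.+1 -> spacetime R d) :
  A `<=` cube -> (forall xi, A xi -> xi ord0 j = c) -> 0 <= M ->
  (forall x y, A x -> A y -> `|Phi x - Phi y| <= M * `|x - y|) ->
  mu.-negligible (Phi @` A : set (mst R d)).
Proof.
move=> Ac Ahyp M0 lipA.
pose cell N (g : {ffun 'I_d -> 'I_N.+1}) : set 'rV[R]_d.+1 :=
  A `&` [set x | forall i, g i = Num.truncn (N.+1%:R * x ord0 (lift j i)) :> nat].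
have diam_cell N g x y : cell N g x -> cell N g y -> `|x - y| <= N.+1%:R^-1.
  move=> [Ax gx] [Ay gy]; apply/(rV_norm_le _ (ltW _)); first by rewrite invr_gt0.
  move=> i; rewrite !mxE; case: (unliftP j i) => [k ->|->]; last first.
    by rewrite (Ahyp _ Ax) (Ahyp _ Ay) subrr normr0 invr_ge0.
  have N0 : 0 < N.+1%:R :> R by [].
  have /andP[x0 _] := Ac _ Ax (lift j k); have /andP[y0 _] := Ac _ Ay (lift j k).
  have := truncn_itv (mulr_ge0 (ltW N0) (ltW x0)).
  have := truncn_itv (mulr_ge0 (ltW N0) (ltW y0)).
  rewrite -gx -gy -[(g k).+1%:R]natr1 => /andP[h1 h2] /andP[h3 h4].
  rewrite -[leRHS]mulr1 ler_pdivlMl // -[X in X * _](gtr0_norm N0) -normrM mulrBr.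
  by rewrite ler_norml; apply/andP; split; lra.
pose B N (g : {ffun 'I_d -> 'I_N.+1}) : set (mst R d) :=
  if pselect (exists x, cell N g x) is left ex
  then cball (Phi (projT1 (cid ex))) (M / N.+1%:R) else set0.
pose U N := \big[setU/set0]_(g : {ffun 'I_d -> 'I_N.+1}) B N g.
have MN N : 0 <= M / N.+1%:R by rewrite divr_ge0.
have mB N g : measurable (B N g).
  by rewrite /B; case: pselect => // ?; exact: measurable_cball.
have mU N : measurable (U N) by exact: bigsetU_measurable.
have PU N : Phi @` A `<=` U N.
  move=> _ [x Ax <-].
  have N0 : 0 < N.+1%:R :> R by [].
  pose g : {ffun 'I_d -> 'I_N.+1} := [ffun i => inord (Num.truncn (N.+1%:R * x ord0 (lift j i)))].
  have cx : cell N g x.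
    split => // i; rewrite ffunE inordK //.
    have /andP[x0 x1] := Ac _ Ax (lift j i).
    rewrite -(ltr_nat R); apply: (@le_lt_trans _ _ (N.+1%:R * x ord0 (lift j i))).
      by have /andP[] := truncn_itv (mulr_ge0 (ltW N0) (ltW x0)).
    by rewrite -[ltRHS]mulr1 ltr_pM2l.
  rewrite /U (bigD1 g) //=; left.
  rewrite /B; case: pselect => [ex|ne]; last by exfalso; apply: ne; exists x.
  case: (cid ex) => y cy /=; rewrite /cball /=.
  apply: le_trans (lipA _ _ Ax (proj1 cy)) _.
  by rewrite ler_wpM2l //; exact: diam_cell cx cy.
have muU N : (mu (U N) <= (((2 * M) ^+ d.+1) * N.+1%:R^-1)%:E)%E.
  apply: le_trans (finite_union_le (e := (2 * (M / N.+1%:R)) ^+ d.+1) (mB N) _) _.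
    move=> g; rewrite /B; case: pselect => [ex|_]; last by rewrite measure0 lee_fin exprn_ge0 // mulr_ge0.
    by rewrite lebesgue_st_cball.
  rewrite lee_fin card_ffun !card_ord natrX.
  have : N.+1%:R != 0 :> R by [].
  move: (N.+1%:R) => a a0; rewrite mulrA exprMn (exprS a^-1) exprVn.
  rewrite le_eqVlt; apply/orP; left; apply/eqP.
  by rewrite mulrCA (mulrCA (a ^+ d)) divff ?mulr1 // expf_neq0.
exists (\bigcap_N U N); split.
- exact: bigcapT_measurable.
- apply/eqP; rewrite eq_le measure_ge0 andbT.
  have le N : (mu (\bigcap_N U N) <= (((2 * M) ^+ d.+1) * N.+1%:R^-1)%:E)%E.
    apply: le_trans (muU N); apply: le_measure; rewrite ?inE //; first exact: bigcapT_measurable.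
    by move=> z; apply.
  have fin : mu (\bigcap_N U N) \is a fin_num.
    by rewrite ge0_fin_numE //; apply: le_lt_trans (le 0%N) (ltry _).
  rewrite -(fineK fin) lee_fin.
  have c0 : (2 * M) ^+ d.+1 * N.+1%:R^-1 @[N --> \oo] --> (0 : R).
    by apply: cvgZ0; exact: cvg_harmonic.
  rewrite -(cvg_lim (@Rhausdorff R) c0); apply: limr_ge; first by apply/cvg_ex; exists 0.
  by apply: nearW => N; rewrite -lee_fin fineK.
- by move=> z hz N _; exact: PU.
Qed.

Lemma image_hyperplane_negligible j (c : R) (Phi : 'rV[R]_d.+1 -> spacetime R d) :
  (forall i, exists2 F, elementary F & forall xi, cube xi -> (Phi xi).1 ord0 i = F xi) ->
  (exists2 F, elementary F & forall xi, cube xi -> (Phi xi).2 = F xi) ->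
  mu.-negligible (Phi @` [set xi | cube xi /\ xi ord0 j = c] : set (mst R d)).
Proof.
move=> h1 [F0 eF0 hF0].
have [F hF] := choice (fun i => let: ex_intro2 F e h := h1 i in ex_intro (fun F => elementary F /\ forall xi, cube xi -> (Phi xi).1 ord0 i = F xi) F (conj e h)).
have [A hA] := choice (fun i => countably_lipschitz_elementary (hF i).1).
have [A0 [cA0 lA0]] := countably_lipschitz_elementary eF0.
have : mu.-negligible (\bigcup_(g : {ffun 'I_d -> nat} * nat)
   (Phi @` ([set xi | cube xi /\ xi ord0 j = c] `&`
     [set xi | (forall i, A i (g.1 i) xi) /\ A0 g.2 xi])) : set (mst R d)).
  apply: negligible_bigcup_countType => -[g k].
  have [M hM] := choice (fun i => (hA i).2 (g i)); have [M0 hM0] := lA0 k.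
  pose Mx := `|M0| + \sum_i `|M i|.
  have Mi i : M i <= Mx.
    apply: le_trans (ler_norm _) _; rewrite /Mx (bigD1 i) //= addrCA lerDl.
    by rewrite addr_ge0 // sumr_ge0.
  have M00 : M0 <= Mx by rewrite /Mx (le_trans (ler_norm _)) // lerDl sumr_ge0.
  apply: (@Lipschitz_hyperplane_negligible _ j c Mx).
  - by move=> x [[]].
  - by move=> x [[]].
  - by rewrite addr_ge0 // sumr_ge0.
  - move=> x y [[cx _] [Ax A0x]] [[cy _] [Ay A0y]].
    apply/st_norm_le; first by rewrite mulr_ge0 // addr_ge0 // sumr_ge0.
    split => [i|]; rewrite /= ?mxE.
      rewrite !(hF i).2 //; apply: le_trans (hM i _ _ (Ax i) (Ay i)).2 _.
      by rewrite ler_wpM2r.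
    rewrite !hF0 //; apply: le_trans (hM0 _ _ A0x A0y).2 _.
    by rewrite ler_wpM2r.
apply: negligibleS => _ [x [cx xj] <-].
have hx i : exists k, A i k x by have [k _ ?] := (hA i).1 x cx; exists k.
have [g hg] := choice hx.
have [k _ Ak] := cA0 x cx.
exists (finfun g, k) => //; exists x => //; split => //; split => //= i.
by rewrite ffunE.
Qed.

End hyperplanes.

(** * Hierarchical meshes *)

Section knots.
Context {R : realType}.
Implicit Types k : seq R.

Lemma seq_max_exists (s : seq R) c : c \in s ->
  exists2 m, m \in s & forall c', c' \in s -> c' <= m.
Proof.
elim: s c => // a s IH c _; case: s IH => [_|b s IH].
  by exists a; rewrite ?mem_seq1 // => c'; rewrite mem_seq1 => /eqP ->.
have [m ms hm] := IH b (mem_head _ _).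
exists (Num.max a m).
  by rewrite in_cons; case: (leP a m) => _; rewrite ?ms ?eqxx ?orbT.
by move=> c'; rewrite in_cons le_max => /predU1P[->|/hm ->]; rewrite ?lexx ?orbT.
Qed.

Lemma seq_min_exists (s : seq R) c : c \in s ->
  exists2 m, m \in s & forall c', c' \in s -> m <= c'.
Proof.
move=> cs; have [|m] := @seq_max_exists (map -%R s) (- c); first exact: map_f.
move=> /mapP[m' m's ->] h; exists m' => // c' /(map_f -%R)/h; by rewrite lerN2.
Qed.

Lemma knot_span_exists k (x : R) : 0 \in k -> 1 \in k -> 0 < x < 1 -> x \notin k ->
  exists a b, knot_span k a b /\ a < x < b.
Proof.
move=> k0 k1 /andP[x0 x1] xk.
have [|a] := @seq_max_exists [seq c <- k | c < x] 0; first by rewrite mem_filter x0.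
rewrite mem_filter => /andP[ax ak] amax.
have [|b] := @seq_min_exists [seq c <- k | x < c] 1; first by rewrite mem_filter x1.
rewrite mem_filter => /andP[xb bk] bmin.
exists a, b; rewrite ax xb; split => //.
rewrite /knot_span ak bk (lt_trans ax xb) /=; apply/hasPn => c ck.
apply/negP => /andP[ac cb]; case: (ltgtP c x) => h.
- by have := amax c; rewrite mem_filter h ck => /(_ isT); rewrite leNgt ac.
- by have := bmin c; rewrite mem_filter h ck => /(_ isT); rewrite leNgt cb.
- by rewrite -h ck in xk.
Qed.

End knots.

Section parameter_mesh.
Context {R : realType} {n : nat} (p : nat) (S : spline_data R n).
Hypothesis adm : spline_admissible p S.

Let knots01 l j : [/\ all (fun c => 0 <= c <= 1) (knots S l j), 0 \in knots S l j &
  1 \in knots S l j].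
Proof.
have [/(_ l j)[_ h c0 c1 _] _ _ _ _] := adm.
by split => //; rewrite -has_pred1 has_count ?c0 ?c1.
Qed.

Let mem_knots l m j c : (l <= m)%N -> c \in knots S l j -> c \in knots S m j.
Proof.
move=> lm; have [_ sub _ _ _] := adm.
rewrite -(subnKC lm); elim: (m - l)%N => [|k IH]; first by rewrite addn0.
by move=> /IH; rewrite addnS; apply: mem_subseq; exact: sub.
Qed.

Lemma parameter_mesh_sub_cube C : parameter_mesh S C -> C `<=` cube.
Proof.
move=> [l [[a [b [hab ->]] _ _]]] xi /= hxi j.
have /andP[aj bj] := hxi j; have /and4P[ak bk _ _] := hab j.
have [/allP h _ _] := knots01 l j.
have /andP[a0 _] := h _ ak; have /andP[_ b1] := h _ bk.
by rewrite (le_lt_trans a0 aj) (lt_le_trans bj b1).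
Qed.

Lemma measurable_cell C l : cells (knots S l) C -> measurable C.
Proof.
move=> [a [b [_ ->]]].
have -> : [set xi : 'rV[R]_n | forall j, a j < xi ord0 j < b j] =
    \bigcap_(j in [set: 'I_n]) (fun xi : 'rV[R]_n => xi ord0 j) @^-1` `]a j, b j[.
  apply/seteqP; split => x h j; first by move=> _ /=; rewrite in_itv /=; exact: h.
  by have := h j I; rewrite /= in_itv.
apply: fin_bigcap_measurable; first exact: finite_finset.
by move=> j _; rewrite -[X in measurable X]setTI; exact: measurable_coord.
Qed.

Lemma finite_cells l : finite_set (cells (knots S l)).
Proof.
pose N := (\max_j size (knots S l j))%N.
pose F (f : {ffun 'I_n -> 'I_N.+1 * 'I_N.+1}) : set 'rV[R]_n :=
  [set xi | forall j, (knots S l j)`_(f j).1 < xi ord0 j < (knots S l j)`_(f j).2].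
apply: (@sub_finite_set _ _ (F @` setT)); last exact/finite_image/finite_finset.
move=> C [a [b [hab ->]]].
exists [ffun j => (inord (index (a j) (knots S l j)), inord (index (b j) (knots S l j)))] => //.
have idx j c : c \in knots S l j -> (knots S l j)`_(inord (index c (knots S l j)) : 'I_N.+1) = c.
  move=> hc; rewrite inordK ?nth_index // ltnS.
  by apply: leq_trans (leq_bigmax j); rewrite ltnW // index_mem.
apply/seteqP; split => xi /= h j; have := h j; rewrite ffunE /=;
  by have /and4P[ak bk _ _] := hab j; rewrite !idx.
Qed.

Lemma finite_parameter_mesh : finite_set (parameter_mesh S).
Proof.
apply: (@sub_finite_set _ _ (\bigcup_(l in `I_(levels S).+1) cells (knots S l))); last first.
  by apply: bigcup_finite => // l _; exact: finite_cells.
move=> C [l [cC sC _]]; exists l => //=; rewrite ltnS leqNgt; apply/negP => hl.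
have [a [b [hab eC]]] := cC.
have [xi Cxi] : C !=set0.
  exists (\row_j ((a j + b j) / 2)); rewrite eC /= => j; rewrite mxE.
  by have /and4P[_ _ ab _] := hab j; apply/andP; split; lra.
have := sC _ Cxi; case: l hl {cC sC hab} => // m hl /= [D rD _].
have [_ _ _ h _] := adm; move: rD; by rewrite (h m).
Qed.

Lemma closure_cell_sub l D xi : cells (knots S l) D -> closure D xi ->
  (forall j, xi ord0 j \notin knots S l j) -> D xi.
Proof.
move=> [a [b [hab ->]]] cl nk j.
have hc : closed [set y : 'rV[R]_n | a j <= y ord0 j <= b j].
  have -> : [set y : 'rV[R]_n | a j <= y ord0 j <= b j] =
    (fun y : 'rV[R]_n => y ord0 j) @^-1` `[a j, b j].
    by apply/seteqP; split => y /=; rewrite in_itv.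
  apply: closed_comp; last exact: interval_closed.
  by move=> y _; exact: coord_continuous.
have /andP[h1 h2] : a j <= xi ord0 j <= b j.
  move: cl; rewrite closureE => /(_ _ (conj hc _)); apply.
  by move=> y /= /(_ j)/andP[? ?]; rewrite !ltW.
have /and4P[ak bk _ _] := hab j; have nj := nk j.
by rewrite !lt_neqAle h1 h2 !andbT; apply/andP; split; apply/eqP => e;
  move: nj; rewrite -?e ?ak // e bk.
Qed.

(** A point off all knots lies in a cell of each level; the relevant one is at
    the deepest level whose subdomain contains the point. *)
Lemma parameter_mesh_cover xi : cube xi ->
  (forall l j, xi ord0 j \notin knots S l j) ->
  exists2 C, parameter_mesh S C & C xi.
Proof.
move=> hxi nk; have [_ _ ref last _] := adm.
have cell l : exists2 C, cells (knots S l) C & C xi.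
  have h j : exists ab : R * R, knot_span (knots S l j) ab.1 ab.2 /\ ab.1 < xi ord0 j < ab.2.
    have [_ k0 k1] := knots01 l j.
    have [a [b ?]] := knot_span_exists k0 k1 (hxi j) (nk l j); by exists (a, b).
  have [f hf] := choice h.
  exists [set y : 'rV[R]_n | forall j, (f j).1 < y ord0 j < (f j).2].
    by exists (fun j => (f j).1), (fun j => (f j).2); split => // j; case: (hf j).
  by move=> j; case: (hf j).
have sub0 : subdomain S 0 xi by move=> j; have /andP[? ?] := hxi j; rewrite !ltW.
have subl l : subdomain S l xi -> (exists2 C, parameter_mesh S C & C xi) \/ subdomain S l.+1 xi.
  move=> hl; have [C cC Cxi] := cell l.
  have [rC|rC] := pselect (refined S l C).
    by right; exists C => //; exact: subset_closure.
  left; exists C => //; exists l; split => //.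
  have [a [b [hab eC]]] := cC.
  case: l hl hab cC {rC} => [_|m [D rD clD]] hab cC.
    move=> y; rewrite eC /= => hy j; have /and4P[ak bk _ _] := hab j.
    have [/allP h _ _] := knots01 0%N j.
    have /andP[a0 _] := h _ ak; have /andP[_ b1] := h _ bk; have /andP[ya yb] := hy j.
    by rewrite (le_trans a0 (ltW ya)) (le_trans (ltW yb) b1).
  move=> y Cy; exists D => //; apply: subset_closure.
  have [cD _] := ref _ _ rD; have Dxi := closure_cell_sub cD clD (nk m).
  have [a' [b' [hab' eD]]] := cD; rewrite eD => j.
  move: Dxi; rewrite eD => /(_ j)/andP[ax xb].
  move: Cxi Cy; rewrite eC => /(_ j)/andP[a1 b1] /(_ j)/andP[a2 b2].
  have /and4P[ak bk _ /hasPn nok] := hab j; have /and4P[ak' bk' _ _] := hab' j.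
  have h1 := nok _ (mem_knots (leqnSn m) ak'); have h2 := nok _ (mem_knots (leqnSn m) bk').
  rewrite (le_lt_trans _ a2) ?(lt_le_trans b2) //.
    rewrite leNgt; apply/negP => h; move: h2; rewrite h andbT => /negP; apply.
    exact: lt_trans a1 xb.
  rewrite leNgt; apply/negP => h; move: h1; rewrite h /= => /negP; apply.
  exact: lt_trans ax b1.
have [//|no] := pselect (exists2 C, parameter_mesh S C & C xi).
have all_sub l : subdomain S l xi by elim: l => // l /subl[].
have /= [D + _] := all_sub (levels S).+1.
by rewrite last.
Qed.

End parameter_mesh.

(** * The physical mesh *)

Section physical_mesh.
Context {R : realType} {d : nat} (Omega : set 'rV[R]_d) (T : R).
Variables (pg : nat) (Sg : spline_data R d.+1) (Phi : 'rV[R]_d.+1 -> spacetime R d).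
Local Notation Q := (cylinder Omega T).
Local Notation mu := (@lebesgue_st R d).
Hypothesis geo : geometry_map pg Sg Phi Q.
Variables (p : nat) (S : spline_data R d.+1).
Hypotheses (adm : spline_admissible p S) (ref : refines S Sg).

Lemma finite_mesh : finite_set (mesh S Phi).
Proof. by apply: finite_image; exact: finite_parameter_mesh adm. Qed.

Lemma mesh_sub K : mesh S Phi K -> K `<=` Q.
Proof.
move=> [C hC <-] _ [xi Cxi <-]; have [[fPhi _ _] _ _ _] := geo.
by apply: fPhi; exact: (parameter_mesh_sub_cube adm hC).
Qed.

Let Phi_x i : exists2 F, elementary F & forall xi, cube xi -> (Phi xi).1 ord0 i = F xi.
Proof. by have [_ h _ _] := geo; exact: spline_space_elementary (h i). Qed.

Let Phi_t : exists2 F, elementary F & forall xi, cube xi -> (Phi xi).2 = F xi.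
Proof. by have [_ _ h _] := geo; exact: spline_space_elementary h. Qed.

(** An element is the set of points [z] with [G z] in the parameter cell and
    [Phi (G z) = z], where [G] extends the inverse of the geometry map. *)
Lemma measurable_mesh K : mesh S Phi K -> measurable (K : set (mst R d)).
Proof.
move=> [C hC <-]; have [C' hC' CC'] := ref hC.
have [_ _ _ /(_ C' hC')[G sG GPhi]] := geo.
have cC := parameter_mesh_sub_cube adm hC.
have cG : continuous G by have [+ _] := sG 0%N [::]; exact.
have mG : measurable_fun [set: mst R d] (G : mst R d -> 'rV[R]_d.+1).
  apply: measurable_fun_rV => i; apply: (@continuous_measurable_st R d (fun z => G z ord0 i)).
  move=> z; apply: (@continuous_comp _ _ _ G (fun x : 'rV[R]_d.+1 => x ord0 i)).
    exact: cG.
  exact: coord_continuous.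
have [F0 eF0 hF0] := Phi_t.
have hPhi i : exists F, elementary F /\ forall xi, cube xi -> (Phi xi).1 ord0 i = F xi.
  by have [F ? ?] := Phi_x i; exists F.
have [F hF] := choice hPhi.
have mEq (f g : mst R d -> R) : measurable_fun [set: mst R d] f ->
    measurable_fun [set: mst R d] g -> measurable [set z | f z = g z].
  move=> mf mg.
  have -> : [set z | f z = g z] = (f \- g) @^-1` [set 0].
    apply/seteqP; split => z /=; first by move=> ->; rewrite subrr.
    by move=> /eqP; rewrite subr_eq0 => /eqP.
  by rewrite -[X in measurable X]setTI; apply: (measurable_funB mf mg) => //; exact: measurable_set1.
have -> : Phi @` C = (G @^-1` C) `&`
    ((\bigcap_(i in [set: 'I_d]) [set z : mst R d | F i (G z) = z.1 ord0 i]) `&`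
     [set z : mst R d | F0 (G z) = z.2]).
  apply/seteqP; split => [_ [xi Cxi <-]|[x t] [/= Cz [h1 h2]]].
    have e := GPhi _ (CC' _ Cxi); have cxi := cC _ Cxi.
    split; first by rewrite /= e.
    by split => [i _|]; rewrite /= e; [rewrite (hF i).2|rewrite hF0].
  exists (G (x, t)) => //; rewrite [LHS]surjective_pairing; congr pair.
    by apply/rowP => i; rewrite (hF i).2 ?h1 //; exact: cC.
  by rewrite hF0 //; exact: cC.
apply: measurableI.
  rewrite -[X in measurable X]setTI; apply: mG => //.
  by case: hC => l [cl _ _]; exact: (measurable_cell cl).
apply: measurableI.
  apply: fin_bigcap_measurable => [|i _]; first exact: finite_finset.
  apply: mEq; first exact: (measurableT_comp (measurable_elementary (hF i).1) mG).
  exact: (measurableT_comp (measurable_coord i) measurable_fst).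
apply: mEq; first exact: (measurableT_comp (measurable_elementary eF0) mG).
exact: measurable_snd.
Qed.

(** A point outside all elements is the image of a point on a hyperplane
    through a knot. *)
Lemma mesh_cover_ae :
  mu.-negligible (Q `\` \bigcup_(K in mesh S Phi) K : set (mst R d)).
Proof.
have : mu.-negligible (\bigcup_(i : nat * 'I_d.+1 * nat)
    (Phi @` [set xi | cube xi /\ xi ord0 i.1.2 = (knots S i.1.1 i.1.2)`_i.2])
    : set (mst R d)).
  by apply: negligible_bigcup_countType => i; exact: image_hyperplane_negligible.
apply: negligibleS => z [Qz nK].
have [[_ _ sPhi] _ _ _] := geo; have [xi cxi ez] := sPhi _ Qz.
have [h|] := pselect (forall l j, xi ord0 j \notin knots S l j).
  have [C hC Cxi] := parameter_mesh_cover adm cxi h.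
  by exfalso; apply: nK; exists (Phi @` C); [exists C|exists xi].
move=> /existsNP[l /existsNP[j /negP/negPn hk]].
exists (l, j, index (xi ord0 j) (knots S l j)) => //=.
by exists xi => //; rewrite nth_index.
Qed.

End physical_mesh.

(** * The estimate *)

Section bound.
Context {R : realType}.

Lemma ge0_integral_setU_le {disp} {X : measurableType disp}
    (mu : {measure set X -> \bar R}) (A B : set X) (f : X -> \bar R) :
  measurable A -> measurable B -> measurable_fun (A `|` B) f ->
  (forall x, 0 <= f x)%E ->
  (\int[mu]_(x in (A `|` B)) f x <= \int[mu]_(x in A) f x + \int[mu]_(x in B) f x)%E.
Proof.
move=> mA mB mf f0.
have mD : measurable (B `\` A) by exact: measurableD.
have E : A `|` B = A `|` (B `\` A) by rewrite setUDr setDv setD0.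
rewrite {1}E ge0_integral_setU //; last 2 first.
- by rewrite -E.
- by apply/disj_setPS => x [Ax [_]].
apply: leeD2l; apply: ge0_subset_integral => //.
by apply: measurable_funS mf => //; exact: measurableU.
Qed.

(** Overlaps of the covering sets can only increase the right-hand side. *)
Lemma ge0_integral_cover_le {disp} {X : measurableType disp}
    (mu : {measure set X -> \bar R}) (Q : set X) (s : seq (set X)) (f : X -> \bar R) :
  measurable Q -> (forall K, K \in s -> measurable K /\ K `<=` Q) ->
  mu.-negligible (Q `\` \big[setU/set0]_(K <- s) K) ->
  measurable_fun Q f -> (forall x, 0 <= f x)%E ->
  (\int[mu]_(x in Q) f x <= \sum_(K <- s) \int[mu]_(x in K) f x)%E.
Proof.
move=> mQ hs neg mf f0.
have [mU UQ leU] : [/\ measurable (\big[setU/set0]_(K <- s) K),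
    \big[setU/set0]_(K <- s) K `<=` Q &
    (\int[mu]_(x in \big[setU/set0]_(K <- s) K) f x <= \sum_(K <- s) \int[mu]_(x in K) f x)%E].
  elim: s hs {neg} => [|K s IH] hs; first by rewrite !big_nil integral_set0; split.
  have [mK KQ] := hs _ (mem_head _ _).
  have [|mU UQ leU] := IH; first by move=> K' hK'; apply: hs; rewrite in_cons hK' orbT.
  rewrite !big_cons; split; [exact: measurableU|by move=> x [/KQ|/UQ]|].
  apply: le_trans (ge0_integral_setU_le _ mK mU _ f0) _; last exact: leeD2l.
  by apply: measurable_funS mf => // x [/KQ|/UQ].
apply: le_trans leU; set U := \big[setU/set0]_(K <- s) K in neg mU UQ *.
have E : Q = U `|` (Q `\` U) by rewrite setUDr setDv setD0 setUC; apply/esym/setUidPl.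
have mD : measurable (Q `\` U) by exact: measurableD.
rewrite [X in (\int[_]_(_ in X) _ <= _)%E]E; apply: le_trans (ge0_integral_setU_le _ mU mD _ f0) _.
  by rewrite -E.
rewrite (@null_set_integral _ _ _ _ (Q `\` U)) ?adde0 //.
- by apply: measurable_funS mf => //; exact: subDsetl.
- by move/negligibleP: neg => ->.
Qed.

Lemma sum_Cauchy_Schwarz (I : Type) (s : seq I) (a b : I -> R) :
  (forall i, 0 <= a i) -> (forall i, 0 <= b i) ->
  \sum_(i <- s) a i * b i <=
  Num.sqrt (\sum_(i <- s) a i ^+ 2) * Num.sqrt (\sum_(i <- s) b i ^+ 2).
Proof.
move=> a0 b0; elim: s => [|i s IH]; first by rewrite !big_nil sqrtr0 mul0r.
rewrite !big_cons.
set A := \sum_(_ <- _) a _ ^+ 2 in IH *; set B := \sum_(_ <- _) b _ ^+ 2 in IH *.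
have A0 : 0 <= A by apply: sumr_ge0 => j _; rewrite sqr_ge0.
have B0 : 0 <= B by apply: sumr_ge0 => j _; rewrite sqr_ge0.
apply: le_trans (lerD (lexx _) IH) _.
rewrite -[leRHS]sqrtrM ?addr_ge0 ?sqr_ge0 // -[leLHS]ger0_norm; last first.
  by rewrite addr_ge0 ?mulr_ge0 ?sqrtr_ge0.
rewrite -sqrtr_sqr; apply: ler_wsqrtr.
have := sqr_ge0 (a i * Num.sqrt B - b i * Num.sqrt A).
have := sqr_sqrtr A0; have := sqr_sqrtr B0.
move: (Num.sqrt A) (Num.sqrt B) (a i) (b i) => u v w z <- <-; rewrite !expr2 => h.
by rewrite -subr_ge0; apply: le_trans h _; rewrite le_eqVlt; apply/orP; left; apply/eqP; ring.
Qed.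

End bound.

Section absolute_values.
Context {R : realType} {disp : measure_display} {X : measurableType disp}.
Variables (mu : {measure set X -> \bar R}) (D : set X).
Hypothesis mD : measurable D.
Implicit Types f g : X -> R.

Lemma L2_norm f : L2 mu D f -> L2 mu D (fun x => `|f x|).
Proof.
move=> [mf f2]; split; first exact: measurableT_comp.
by apply: eq_integrable f2 => // x _; rewrite -normrX ger0_norm ?sqr_ge0.
Qed.

Lemma nrm_norm f : nrm mu D (fun x => `|f x|) = nrm mu D f.
Proof.
congr Num.sqrt; apply: eq_Rintegral => x _.
by rewrite -normrM ger0_norm // -expr2 sqr_ge0.
Qed.

End absolute_values.

Lemma sum_bound {R : realType} (I : eqType) (s : seq I) (x a b A B : I -> R) :
  (forall i, i \in s -> `|x i| <= a i * b i) ->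
  (forall i, 0 <= a i) -> (forall i, 0 <= b i) ->
  (forall i, i \in s -> a i ^+ 2 = A i) -> (forall i, i \in s -> b i ^+ 2 = B i) ->
  `|\sum_(i <- s) x i| <= Num.sqrt (\sum_(i <- s) A i) * Num.sqrt (\sum_(i <- s) B i).
Proof.
move=> h a0 b0 hA hB; apply: le_trans (ler_norm_sum _ _ _) _.
rewrite -(eq_big_seq _ hA) -(eq_big_seq _ hB).
apply: le_trans (sum_Cauchy_Schwarz s a0 b0).
by rewrite !big_seq; exact: ler_sum.
Qed.

(** The constant is [2] for the final traces, whose squares enter the norms with
    weight [1/2], plus [1] for each of the four other terms. *)
Lemma combine_bounds {R : realType} (t1 t2 t3 t4 t5 gu gv su sv du dv eu lu : R) :
  0 <= gu -> 0 <= gv -> 0 <= su -> 0 <= sv -> 0 <= du -> 0 <= dv -> 0 <= eu -> 0 <= lu ->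
  `|t1| <= Num.sqrt eu * Num.sqrt dv -> `|t2| <= Num.sqrt su * Num.sqrt sv ->
  `|t3| <= Num.sqrt gu * Num.sqrt gv -> `|t4| <= Num.sqrt du * Num.sqrt dv ->
  `|t5| <= Num.sqrt lu * Num.sqrt dv ->
  `|t2 - t1 + t3 + (t4 - t5)| <=
    6 * Num.sqrt (gu + 2^-1 * su + du + (eu + lu)) * Num.sqrt (gv + 2^-1 * sv + dv).
Proof.
move=> gu0 gv0 su0 sv0 du0 dv0 eu0 lu0 b1 b2 b3 b4 b5.
set X := gu + _ + _ + _; set Y := gv + _ + _.
have X0 : 0 <= X by rewrite /X; lra.
have Y0 : 0 <= Y by rewrite /Y; lra.
have mono x y : x <= X -> y <= Y -> Num.sqrt x * Num.sqrt y <= Num.sqrt X * Num.sqrt Y.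
  by move=> hx hy; apply: ler_pM; rewrite ?sqrtr_ge0 //; exact: ler_wsqrtr.
have c1 := le_trans b1 (mono eu dv ltac:(by rewrite /X; lra) ltac:(by rewrite /Y; lra)).
have c3 := le_trans b3 (mono gu gv ltac:(by rewrite /X; lra) ltac:(by rewrite /Y; lra)).
have c4 := le_trans b4 (mono du dv ltac:(by rewrite /X; lra) ltac:(by rewrite /Y; lra)).
have c5 := le_trans b5 (mono lu dv ltac:(by rewrite /X; lra) ltac:(by rewrite /Y; lra)).
have c2 : Num.sqrt su * Num.sqrt sv <= 2 * (Num.sqrt X * Num.sqrt Y).
  have -> : su = 2 * (2^-1 * su) by field.
  have -> : sv = 2 * (2^-1 * sv) by field.
  rewrite (@sqrtrM _ 2 (2^-1 * su)) // (@sqrtrM _ 2 (2^-1 * sv)) //.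
  rewrite mulrACA -expr2 sqr_sqrtr // ler_wpM2l //.
  by apply: mono; rewrite /X /Y; lra.
rewrite -mulrA; move: (Num.sqrt X * Num.sqrt Y) c1 c2 c3 c4 c5 b2 => N c1 c2 c3 c4 c5 b2.
apply: le_trans (ler_normD _ _) _; apply: le_trans (lerD (ler_normD _ _) (lexx _)) _.
apply: le_trans (lerD (lerD (ler_normB _ _) (lexx _)) (ler_normB _ _)) _.
have := le_trans b2 c2.
have -> : 6 * N = ((2 * N + N) + N) + (N + N) by ring.
by move=> c2'; apply: lerD; [apply: lerD => //; exact: lerD|exact: lerD].
Qed.

Section boundedness.
Context {R : realType} {d : nat} (Omega : set 'rV[R]_d) (T : R).
Hypotheses (oO : open Omega) (bO : bounded_set Omega) (T0 : 0 < T).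
Local Notation Q := (cylinder Omega T).
Local Notation mu := (@lebesgue_st R d).
Local Notation nu := (lebesgue_rV d).
Local Notation dt := (weak_dt Omega T).
Variables (p : nat) (S : spline_data R d.+1) (Phi : 'rV[R]_d.+1 -> spacetime R d).
Local Notation M := (mesh S Phi).
Hypotheses (finM : finite_set M)
  (mM : forall K, M K -> measurable (K : set (mst R d)))
  (subM : forall K, M K -> K `<=` Q)
  (coverM : mu.-negligible (Q `\` \bigcup_(K in M) K : set (mst R d))).
Variable theta : set (spacetime R d) -> R.
Local Notation delta := (delta theta).
Hypothesis delta0 : forall K, M K -> 0 < delta K.

Let mQ : measurable (Q : set (mst R d)) := measurable_cylinder T oO.
Let s : seq (set (spacetime R d)) := finmap.enum_fset (fset_set M).

Let inM K : K \in s -> M K.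
Proof. by rewrite /s in_fset_set // => /set_mem. Qed.

Let sq_delta (f : spacetime R d -> R) K : K \in s ->
  (Num.sqrt (delta K) * nrm mu (K : set (mst R d)) f) ^+ 2 = delta K * norm2 K f.
Proof. by move=> /inM/delta0/ltW h; rewrite exprMn sqr_sqrtr // sqr_nrm. Qed.

Let sq_deltaV (f : spacetime R d -> R) K : K \in s ->
  (Num.sqrt (delta K)^-1 * nrm mu (K : set (mst R d)) f) ^+ 2 = (delta K)^-1 * norm2 K f.
Proof.
by move=> /inM/delta0/ltW h; rewrite exprMn sqr_sqrtr ?invr_ge0 // sqr_nrm.
Qed.

Let nonneg (f : spacetime R d -> R) (c : R) K : 0 <= Num.sqrt c * nrm mu (K : set (mst R d)) f.
Proof. by rewrite mulr_ge0 ?sqrtr_ge0 ?nrm_ge0. Qed.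

(** The one term in which an integral over the cylinder is split into
    integrals over elements: the mesh has to cover it up to a null set. *)
Let duality_bound u v : L2 mu (Q : set (mst R d)) u -> L2 mu (Q : set (mst R d)) v ->
  `|inner Q u v| <= Num.sqrt (\sum_(K <- s) (delta K)^-1 * norm2 K u) *
                    Num.sqrt (\sum_(K <- s) delta K * norm2 K v).
Proof.
move=> hu hv.
pose F z := `|u z| * `|v z|.
have huv := L2_integrableM mQ (L2_norm mQ hu) (L2_norm mQ hv).
have LK f K : K \in s -> L2 mu (Q : set (mst R d)) f -> L2 mu (K : set (mst R d)) f.
  by move=> /inM hK hf; exact: (L2S mQ (mM hK) (subM hK) hf).
have intK K : K \in s -> mu.-integrable (K : set (mst R d)) (EFin \o F).
  by move=> /inM hK; exact: (integrableS mQ (mM hK) (subM hK) huv).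
have step1 : `|inner Q u v| <= \int[mu]_(z in (Q : set (mst R d))) F z.
  apply: le_trans (le_normr_Rintegral mQ (L2_integrableM mQ hu hv)) _.
  rewrite le_eqVlt; apply/orP; left; apply/eqP; apply: eq_Rintegral => z _.
  exact: normrM.
have step2 : \int[mu]_(z in (Q : set (mst R d))) F z <=
    \sum_(K <- s) \int[mu]_(z in (K : set (mst R d))) F z.
  rewrite -lee_fin /Rintegral fineK; last exact: integrable_fin_num huv.
  rewrite -sumEFin big_seq.
  rewrite (eq_bigr (fun K => \int[mu]_(z in (K : set (mst R d))) (F z)%:E)%E); last first.
    by move=> K hK; rewrite fineK //; apply: integrable_fin_num (intK K hK); exact: mM (inM hK).
  rewrite -big_seq; apply: ge0_integral_cover_le => //.
  - by move=> K /inM hK; split; [exact: mM|exact: subM].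
  - apply: negligibleS coverM => z [Qz nU]; split => // -[K hK Kz]; apply: nU.
    have Ks : K \in s by rewrite /s in_fset_set // mem_set.
    by rewrite -bigcup_seq; exists K.
  - exact: measurable_int huv.
  - by move=> z; rewrite lee_fin mulr_ge0.
apply: le_trans step1 _; apply: le_trans step2 _; apply: le_trans (ler_norm _) _.
apply: (sum_bound (a := fun K => Num.sqrt (delta K)^-1 * nrm mu (K : set (mst R d)) u)
  (b := fun K => Num.sqrt (delta K) * nrm mu (K : set (mst R d)) v)) => [K hK| | | |].
- have mK := mM (inM hK); have dK := delta0 (inM hK).
  have := Cauchy_Schwarz mK (L2_norm mK (LK _ _ hK hu)) (L2_norm mK (LK _ _ hK hv)).
  rewrite !nrm_norm => /le_trans; apply; rewrite sqrtrV ?(ltW dK) //.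
  have sd : Num.sqrt (delta K) != 0 by rewrite gt_eqF // sqrtr_gt0.
  by rewrite mulrACA mulVf // mul1r.
- by move=> K; exact: nonneg.
- by move=> K; exact: nonneg.
- by move=> K hK; exact: sq_deltaV.
- by move=> K hK; exact: sq_delta.
Qed.

Let stabilization_bound (f : set (spacetime R d) -> spacetime R d -> R) v :
  (forall K, M K -> L2 mu (K : set (mst R d)) (f K)) ->
  (forall K, M K -> L2 mu (K : set (mst R d)) v) ->
  `|\sum_(K <- s) delta K * inner K (f K) v| <=
  Num.sqrt (\sum_(K <- s) delta K * norm2 K (f K)) *
  Num.sqrt (\sum_(K <- s) delta K * norm2 K v).
Proof.
move=> hf hv.
apply: (sum_bound (a := fun K => Num.sqrt (delta K) * nrm mu (K : set (mst R d)) (f K))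
  (b := fun K => Num.sqrt (delta K) * nrm mu (K : set (mst R d)) v)) => [K hK| | | |].
- have mK := mM (inM hK); have dK := delta0 (inM hK).
  rewrite normrM (gtr0_norm dK) mulrACA -expr2 sqr_sqrtr ?(ltW dK) //.
  rewrite ler_wpM2l ?(ltW dK) //.
  exact: (Cauchy_Schwarz mK (hf _ (inM hK)) (hv _ (inM hK))).
- by move=> K; exact: nonneg.
- by move=> K; exact: nonneg.
- by move=> K hK; exact: sq_delta.
- by move=> K hK; exact: sq_delta.
Qed.

Let gradient_bound u v :
  `|inner_grad Q u v| <= Num.sqrt (inner_grad Q u u) * Num.sqrt (inner_grad Q v v).
Proof.
apply: (sum_bound (a := fun i => nrm mu (Q : set (mst R d)) (wd Q (dir_x i) u))
  (b := fun i => nrm mu (Q : set (mst R d)) (wd Q (dir_x i) v))) => [i _| | | |].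
- exact: (Cauchy_Schwarz mQ (wd_L2 _ _ mQ) (wd_L2 _ _ mQ)).
- by move=> i; exact: nrm_ge0.
- by move=> i; exact: nrm_ge0.
- by move=> i _; exact: sqr_nrm.
- by move=> i _; exact: sqr_nrm.
Qed.

Lemma a_loc_bounded u v :
  L2 mu (Q : set (mst R d)) u -> L2 mu (Q : set (mst R d)) v ->
  is_time_trace Omega T 0 u (fun=> 0) -> is_time_trace Omega T 0 v (fun=> 0) ->
  `|a_loc Omega T S Phi theta u v| <=
    6 * norm_loc_star Omega T S Phi theta u * norm_loc Omega T S Phi theta v.
Proof.
move=> hu hv tu tv.
have [Lu Lv ibp] := integration_by_parts_time oO bO T0 hu hv tu tv.
have mO := open_measurable_rV oO.
have Ldt w K : M K -> L2 mu (K : set (mst R d)) (dt w).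
  by move=> hK; exact: (L2S mQ (mM hK) (subM hK) (wd_L2 _ _ mQ)).
have Llap K : M K -> L2 mu (K : set (mst R d)) (wlap K u) by move=> hK; apply: wlap_L2; exact: mM.
pose gu := inner_grad Q u u; pose gv := inner_grad Q v v.
pose su := norm2_SigmaT Omega T u; pose sv := norm2_SigmaT Omega T v.
pose du := \sum_(K <- s) delta K * norm2 K (dt u).
pose dv := \sum_(K <- s) delta K * norm2 K (dt v).
pose eu := \sum_(K <- s) (delta K)^-1 * norm2 K u.
pose lu := \sum_(K <- s) delta K * norm2 K (wlap K u).
have ES w : norm2_SigmaT Omega T w = nrm nu Omega (time_trace Omega T T w) ^+ 2.
  by rewrite sqr_nrm; apply: eq_Rintegral => x _; rewrite expr2.
have grad0 w : 0 <= inner_grad Q w w by apply: sumr_ge0 => i _; exact: ip_ge0.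
have gu0 : 0 <= gu := grad0 u.
have gv0 : 0 <= gv := grad0 v.
have su0 : 0 <= su by rewrite /su ES sqr_ge0.
have sv0 : 0 <= sv by rewrite /sv ES sqr_ge0.
have sum0 (c : set (spacetime R d) -> R) (f : set (spacetime R d) -> spacetime R d -> R) :
    (forall K, M K -> 0 <= c K) -> 0 <= \sum_(K <- s) c K * norm2 K (f K).
  move=> c0; rewrite big_seq; apply: sumr_ge0 => K /inM hK; apply: mulr_ge0; first exact: c0.
  exact: (ip_ge0 mu (K : set (mst R d))).
have d0 K : M K -> 0 <= delta K by move=> /delta0/ltW.
have du0 : 0 <= du by exact: (sum0 _ (fun=> dt u)).
have dv0 : 0 <= dv by exact: (sum0 _ (fun=> dt v)).
have eu0 : 0 <= eu by apply: (sum0 _ (fun=> u)) => K /d0; rewrite invr_ge0.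
have lu0 : 0 <= lu by exact: (sum0 _ (fun K => wlap K u)).
have eX : norm2_loc_star Omega T S Phi theta u = gu + 2^-1 * su + du + (eu + lu).
  by rewrite /norm2_loc_star /norm2_loc !fsbig_finite // -big_split.
have eY : norm2_loc Omega T S Phi theta v = gv + 2^-1 * sv + dv.
  by rewrite /norm2_loc fsbig_finite.
(* The two gradient terms of each element cancel by the definition of the
   conormal pairing. *)
have eA : a_loc Omega T S Phi theta u v =
    (ip nu Omega (time_trace Omega T T u) (time_trace Omega T T v) - inner Q u (dt v)) +
    inner_grad Q u v + (\sum_(K <- s) delta K * inner K (dt u) (dt v) -
      \sum_(K <- s) delta K * inner K (wlap K u) (dt v)).
  rewrite /a_loc fsbig_finite // -sumrB -ibp -[ip _ _ u (dt v)]/(inner Q u (dt v)) addrK.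
  by congr (_ + _); apply: eq_bigr => K _; rewrite /conormal_pairing; ring.
have b1 := duality_bound hu (wd_L2 dir_t v mQ).
have b2 : `|ip nu Omega (time_trace Omega T T u) (time_trace Omega T T v)| <=
    Num.sqrt su * Num.sqrt sv.
  have e w : Num.sqrt (norm2_SigmaT Omega T w) = nrm nu Omega (time_trace Omega T T w).
    by rewrite ES sqrtr_sqr ger0_norm // nrm_ge0.
  have eq_le (x y z y' z' : R) : y' = y -> z' = z -> x <= y * z -> x <= y' * z'.
    by move=> -> ->.
  exact: (eq_le _ _ _ _ _ (e u) (e v) (Cauchy_Schwarz mO Lu Lv)).
have b3 := gradient_bound u v.
have b4 := stabilization_bound (fun K hK => Ldt u K hK) (fun K hK => Ldt v K hK).
have b5 := stabilization_bound Llap (fun K hK => Ldt v K hK).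
rewrite /norm_loc_star /norm_loc eX eY eA.
exact: (combine_bounds gu0 gv0 su0 sv0 du0 dv0 eu0 lu0 b1 b2 b3 b4 b5).
Qed.

End boundedness.

Theorem lemma4p3 (R : realType) (d : nat) (Omega : set 'rV[R]_d) (T : R)
    (pg : nat) (Sg : spline_data R d.+1) (Phi : 'rV[R]_d.+1 -> spacetime R d)
    (p : nat) (Cu Cint : R) :
  (1 <= d <= 3)%N -> lipschitz_domain Omega -> 0 < T ->
  (2 <= pg)%N -> spline_admissible pg Sg ->
  geometry_map pg Sg Phi (cylinder Omega T) ->
  (2 <= p)%N -> 0 < Cu -> 0 < Cint ->
  exists mu : R, 0 < mu /\
  forall S : spline_data R d.+1,
    spline_admissible p S ->
    refines S Sg ->
    quasi_uniform S Phi Cu ->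
    inverse_inequality p S Phi Cint ->
  forall theta : set (spacetime R d) -> R,
    (forall K, mesh S Phi K ->
       0 < theta K /\ theta K <= diam K / (d%:R * Cint ^+ 2)) ->
  forall u v : spacetime R d -> R,
    V0h_star Omega T p S Phi u -> V0h Omega T p S Phi v ->
    `|a_loc Omega T S Phi theta u v| <=
      mu * norm_loc_star Omega T S Phi theta u * norm_loc Omega T S Phi theta v.
Proof.
move=> _ [_ oO _ bO _] T0 _ _ geo _ _ _; exists 6; split => // S adm ref _ _.
move=> theta htheta u v [w [v0 [[Vw _] [_ Vv0] ->]]] [_ Vv].
have [[Lw _ _] dw tw] := Vw; have [[Lv0 _ _] dv0 tv0] := Vv0.
have [[Lv _ _] _ tv] := Vv.
have mQ := measurable_cylinder T oO.
have Lu := L2D mQ Lw Lv0.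
have tu : is_time_trace Omega T 0 (w \+ v0) (fun=> 0).
  have := is_time_trace_add oO bO Lw Lv0 dw dv0 tw tv0.
  by rewrite (_ : (fun=> 0) \+ (fun=> 0) = fun=> 0) //; apply/funext => x /=; rewrite addr0.
have delta0 K : mesh S Phi K -> 0 < delta theta K.
  move=> /htheta[th0 thle]; apply: mulr_gt0 => //.
  rewrite ltNge; apply/negP => diam0.
  have : theta K <= 0 by apply: le_trans thle _; rewrite mulr_le0_ge0 // invr_ge0 mulr_ge0 // sqr_ge0.
  by rewrite leNgt th0.
exact: (a_loc_bounded oO bO T0 (finite_mesh Phi adm)
  (fun K => measurable_mesh geo adm ref (K := K)) (fun K => mesh_sub geo adm (K := K))
  (mesh_cover_ae geo adm) delta0 Lu Lv tu tv).
Qed.
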